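(* For all real $z>0$, $$\begin{aligned}&S_{3,2}(1-e^{2z})-S_{3,2}(1-e^{-2z})-2S_{3,2}(e^{-2z})\\&\quad=-3\operatorname{Li}_5(e^{-2z})-2z\left(\operatorname{Li}_4(1-e^{2z})+\operatorname{Li}_4(1-e^{-2z})+\operatorname{Li}_4(e^{-2z})\right)+2\log(2\sinh z)\operatorname{Li}_4(e^{-2z})\\&\qquad-\frac{2z^5}{5}-\frac{4z^3}{3}\log(2\sinh z)^2+2\log(2\sinh z)\left(\frac{z^4}{3}-\zeta(4)+2z\zeta(3)-2z^2\zeta(2)\right)\\&\qquad-2z^2\zeta(3)-3z\zeta(4)+2\zeta(2)\zeta(3)-\zeta(5).\end{aligned}$$
   Context: For integers $m,k\ge1$ and $x\in\mathbb{C}\setminus[1,\infty)$ the Nielsen polylogarithm is $$S_{m,k}(x)=\frac{(-1)^{m+k-1}}{(m-1)!\,k!}\int_0^1 \log(t)^{m-1}\log(1-xt)^k\,\frac{dt}{t}$$ with the principal branch of the logarithm. $\operatorname{Li}_m(x)=\sum_{n\ge1}x^n n^{-m}$ for $|x|<1$ is the polylogarithm, extended by analytic continuation to $\mathbb{C}\setminus[1,\infty)$ (principal branch). $\zeta$ is the Riemann zeta function. $\log(y)^2$ means $(\log y)^2$. *)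

(* Defs.v *)
From Stdlib Require Import Reals Factorial ClassicalEpsilon.
From Coquelicot Require Import Coquelicot.

Open Scope R_scope.

(* Principal argument, with values in (-PI, PI]; its value at 0 is irrelevant. *)
Definition Carg (z : C) : R :=
  if Rle_dec 0 (Im z) then acos (Re z / Cmod z) else - acos (Re z / Cmod z).

Definition Clog (z : C) : C := (ln (Cmod z), Carg z).

Definition slit_plane (x : C) : Prop := ~ (Im x = 0 /\ 1 <= Re x).

(* For m, k >= 1.  The integral is improper at 0 (for k = 1 and m >= 2 the
   integrand is unbounded there); on the slit plane it is regular at 1. *)
Definition nielsen (m k : nat) (x : C) : C :=
  (RtoC ((-1) ^ (m + k - 1) / (INR (fact (m - 1)) * INR (fact k))) *
   RInt_gen (V := C_R_CompleteNormedModule)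
     (fun t : R =>
        (Cpow (Clog (RtoC t)) (m - 1) * Cpow (Clog (1 - x * RtoC t)) k
         / RtoC t)%C)
     (at_right 0) (at_point 1))%C.

Definition analytic_at (f : C -> C) (x : C) : Prop :=
  exists (a : nat -> C) (r : R), 0 < r /\
    forall y : C, Cmod (y - x) < r ->
      is_pseries (K := C_AbsRing) (V := C_NormedModule) a (y - x)%C (f y).

(* The summation index is shifted: the n-th term is x^(n+1) / (n+1)^m. *)
Definition is_polylog (m : nat) (f : C -> C) : Prop :=
  (forall x : C, slit_plane x -> analytic_at f x) /\
  (forall x : C, Cmod x < 1 ->
     is_series (K := C_AbsRing) (V := C_NormedModule)
       (fun n : nat => (Cpow x (S n) / Cpow (RtoC (INR (S n))) m)%C) (f x)).

(* The slit plane is connected, so is_polylog m determines the values there;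
   the values on [1, oo) are arbitrary. *)
Definition Li (m : nat) : C -> C :=
  epsilon (inhabits (fun _ : C => RtoC 0)) (is_polylog m).

(* The Riemann zeta function on the half-line s > 1. *)
Definition zeta (s : R) : R := Series (fun n : nat => / Rpower (INR (S n)) s).

(* Main.v *)
Require Import Defs.
From Stdlib Require Import Reals ClassicalEpsilon Lra Lia.
From Coquelicot Require Import Coquelicot.

(** Put q = exp (-2z), so that 0 < q < 1, ln q = -2z, 1 - exp (2z) = 1 - 1/q
    and ln (2 sinh z) = ln (1 - q) - (ln q) / 2.  Every argument is then a real
    number below 1, and the formula is a relation between functions of q.

    Such relations are proved by differentiation.  Write D = q d/dq.  On the
    three arguments q, 1 - q and 1 - 1/q the polylogarithms and the Nielsen
    polylogarithms satisfy D f_k(q) = f_(k-1)(q),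
    D f_k(1 - q) = - q/(1-q) f_(k-1)(1 - q) and
    D f_k(1 - 1/q) = - 1/(1-q) f_(k-1)(1 - 1/q), so D lowers the weight by one
    and splits the weight 5 relation into a coefficient of 1 and a coefficient
    of q/(1-q).  These are the two weight 4 relations [nielsen2_2_sum] and
    [nielsen2_2_difference]; their derivatives reduce in the same way to the
    weight 3 relations [nielsen2_1_reflection], [nielsen2_1_landen],
    [trilog_three_term] and to the two dilogarithm relations
    [dilog_reflection], [dilog_landen].  At each level the constant of
    integration is the limit for q -> 1, where f(1 - q) and f(1 - 1/q) vanish
    and f(q) tends to a zeta value, the powers of ln (1 - q) being always
    multiplied by something that vanishes linearly.

    The constants of weight 4 and 5 contain S_(2,2)(1) and S_(3,2)(1), the
    double zeta values zeta(3,1) and zeta(4,1).  Euler's evaluations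
    [mzv_3_1] and [mzv_4_1] follow from the stuffle product, the sum formula
    and, in weight 4, the shuffle product.

    To connect this with the definitions, both families are built from one
    operator, the average T f(x) = int_0^1 f(x s) ds, for which
    (x T f(x))' = f(x): Li_m(x) = x T^m (1/(1-x)) and
    S_(m,2)(x) = x T^(m+1) (- ln (1-x) / (1-x)).  The integral defining
    S_(3,2) is computed with an explicit primitive ([nielsen_3_2_real]).
    For Li_m the analytic continuation has to be exhibited:
    f |-> (T^m f)(1) is a bounded linear functional whose value at t^n is
    1/(n+1)^m, and applying it to t |-> y / (1 - y t) gives a function of y
    whose Taylor series at every point of the slit plane comes from the
    geometric series of the resolvent ([is_polylog_complex_polylog]).  Any
    other continuation agrees with it at the real points below 1
    ([is_polylog_unique_real]), hence [Li_real]. *)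

(** * Averages over segments from the origin *)

(** Equalities coming from lemmas on general algebraic structures are typed at
    a carrier that is only convertible to R, which [ring] and [field] do not
    see through. *)
Ltac real_eq := match goal with |- @eq _ ?a ?b => change (@eq R a b) end.

Definition continuous_below (b : R) (f : R -> R) : Prop :=
  forall x, x < b -> continuous f x.

(** This is (1/x) int_0^x f for x <> 0, written so that x = 0 needs no case
    distinction and that averaging commutes with rescaling the variable. *)
Definition avg (f : R -> R) (x : R) : R := RInt (fun s => f (x * s)) 0 1.

Definition avg_iter (m : nat) (f : R -> R) : R -> R := Nat.iter m avg f.

Lemma continuous_below_segment (b : R) (f : R -> R) (x s : R) :
  0 < b -> continuous_below b f -> x < b -> 0 <= s <= 1 ->
  continuous f (x * s).
Proof.
intros Hb Hf Hx Hs. apply Hf.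
destruct (Rle_dec x 0) as [H|H]; nra.
Qed.

Lemma ex_RInt_below (b : R) (f : R -> R) (u v : R) :
  continuous_below b f -> u < b -> v < b -> ex_RInt f u v.
Proof.
intros Hf Hu Hv. apply (ex_RInt_continuous f u v). intros z Hz. apply Hf.
unfold Rmax in Hz; destruct (Rle_dec u v); lra.
Qed.

Lemma ex_RInt_avg (b : R) (f : R -> R) (x : R) :
  0 < b -> continuous_below b f -> x < b ->
  ex_RInt (fun s => f (x * s)) 0 1.
Proof.
intros Hb Hf Hx. apply (ex_RInt_continuous (fun s => f (x * s)) 0 1).
intros s Hs. rewrite Rmin_left, Rmax_right in Hs by lra.
apply (continuous_comp (fun s => x * s) f).
- apply (continuous_mult (fun _ => x) (fun s => s)).
  apply continuous_const. apply continuous_id.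
- now apply continuous_below_segment with b.
Qed.

Lemma avg_mul_eq (b : R) (f : R -> R) (x : R) :
  0 < b -> continuous_below b f -> x < b -> x * avg f x = RInt f 0 x.
Proof.
intros Hb Hf Hx. unfold avg.
assert (E : is_RInt (fun s => scal x (f (x * s + 0))) 0 1 (RInt f 0 x)).
{ apply (is_RInt_comp_lin (V := R_NormedModule) f x 0 0 1 (RInt f 0 x)).
  replace (x * 0 + 0) with 0 by ring. replace (x * 1 + 0) with x by ring.
  apply (RInt_correct f). apply ex_RInt_below with b; auto. }
symmetry. rewrite <- (is_RInt_unique _ _ _ _ E).
rewrite (RInt_ext _ (fun s => scal x (f (x * s)))).
- apply (RInt_scal (V := R_CompleteNormedModule) (fun s => f (x * s)) 0 1 x).
  now apply ex_RInt_avg with b.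
- intros s _. now rewrite Rplus_0_r.
Qed.

(** By the substitution t = x s, x * avg f x is the primitive of f vanishing at
    0.  Iterating the average therefore produces the functions in which each is
    a primitive of the previous one divided by the variable. *)
Lemma is_derive_mul_avg (b : R) (f : R -> R) (x : R) :
  0 < b -> continuous_below b f -> x < b ->
  is_derive (fun y => y * avg f y) x (f x).
Proof.
intros Hb Hf Hx.
assert (Hloc : locally x (fun y => y < b)).
{ exists (mkposreal (b - x) ltac:(lra)). intros y Hy.
  unfold ball in Hy; simpl in Hy; unfold AbsRing_ball, abs, minus, plus, opp in Hy;
  simpl in Hy. apply Rabs_def2 in Hy. lra. }
apply is_derive_ext_loc with (fun y => RInt f 0 y).
- eapply filter_imp; [|exact Hloc].
  intros y Hy. symmetry. now apply avg_mul_eq with b.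
- apply (is_derive_RInt f (fun y => RInt f 0 y) 0 x).
  + eapply filter_imp; [|exact Hloc]. intros y Hy.
    apply (RInt_correct f). apply ex_RInt_below with b; auto.
  + now apply Hf.
Qed.

Lemma avg_0 (f : R -> R) : avg f 0 = f 0.
Proof.
unfold avg. rewrite (RInt_ext _ (fun _ => f 0)).
- rewrite RInt_const. unfold scal; simpl; unfold mult; simpl. ring.
- intros s _. now rewrite Rmult_0_l.
Qed.

Lemma continuous_below_avg (b : R) (f : R -> R) :
  0 < b -> continuous_below b f -> continuous_below b (avg f).
Proof.
intros Hb Hf x Hx.
assert (Hd := is_derive_mul_avg b f x Hb Hf Hx).
(* At 0 continuity of the average is the statement that y * avg f y has
   derivative f 0 there, because avg f 0 = f 0. *)
destruct (Req_dec x 0) as [->|Hx0].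
- apply continuity_pt_filterlim. intros eps He.
  apply is_derive_Reals in Hd. destruct (Hd eps He) as [d Hd'].
  exists d; split; [apply cond_pos|]. intros y [[_ Hy0] Hy].
  simpl in *. unfold Rdist in *. rewrite avg_0.
  assert (Hy1 : y <> 0) by auto.
  rewrite Rminus_0_r in Hy. specialize (Hd' y Hy1 Hy).
  rewrite Rplus_0_l in Hd'.
  replace (avg f y) with ((y * avg f y - 0 * avg f 0) / y) by (field; auto).
  exact Hd'.
- apply (continuous_ext_loc _ (fun y => / y * (y * avg f y))).
  + exists (mkposreal (Rabs x) (Rabs_pos_lt _ Hx0)). intros y Hy.
    assert (y <> 0).
    { intros ->. unfold ball in Hy; simpl in Hy;
      unfold AbsRing_ball, abs, minus, plus, opp in Hy; simpl in Hy.
      rewrite Rplus_0_l, Rabs_Ropp in Hy. lra. }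
    real_eq; field; auto.
  + apply (continuous_mult (fun y => / y) (fun y => y * avg f y)).
    * apply continuity_pt_filterlim, continuity_pt_inv; [|exact Hx0].
      apply derivable_continuous_pt, derivable_pt_id.
    * apply (ex_derive_continuous (fun y => y * avg f y)).
      eexists; exact Hd.
Qed.

Lemma continuous_below_avg_iter (b : R) (f : R -> R) (m : nat) :
  0 < b -> continuous_below b f -> continuous_below b (avg_iter m f).
Proof.
intros Hb Hf. induction m; simpl; auto. now apply continuous_below_avg.
Qed.

Lemma is_derive_mul_avg_iter (b : R) (f : R -> R) (m : nat) (x : R) :
  0 < b -> continuous_below b f -> x < b ->
  is_derive (fun y => y * avg_iter (S m) f y) x (avg_iter m f x).
Proof.
intros Hb Hf Hx. simpl. apply is_derive_mul_avg with b; auto.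
now apply continuous_below_avg_iter.
Qed.

(** Rescaling commutes with averaging: this identifies the value at 1 for the
    kernel t |-> 1/(1 - x t) with the value at x for the kernel 1/(1 - t). *)
Lemma avg_iter_scale (m : nat) (f : R -> R) (c x : R) :
  avg_iter m (fun t => f (c * t)) x = avg_iter m f (c * x).
Proof.
revert x. induction m; intros x; simpl; auto.
unfold avg. apply RInt_ext. intros s _.
rewrite IHm. now rewrite Rmult_assoc.
Qed.

Lemma avg_iter_ext (m : nat) (f g : R -> R) :
  (forall t, 0 <= t <= 1 -> f t = g t) ->
  forall x, 0 <= x <= 1 -> avg_iter m f x = avg_iter m g x.
Proof.
intros H. induction m; intros x Hx; simpl; auto.
unfold avg. apply RInt_ext. rewrite Rmin_left, Rmax_right by lra.
intros s Hs. apply IHm. nra.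
Qed.

Lemma avg_iter_plus (b : R) (m : nat) (f g : R -> R) :
  0 < b -> continuous_below b f -> continuous_below b g ->
  forall x, x < b ->
  avg_iter m (fun t => f t + g t) x = avg_iter m f x + avg_iter m g x.
Proof.
intros Hb Hf Hg. induction m; intros x Hx; simpl; auto.
unfold avg at 1. rewrite (RInt_ext _
  (fun s => plus (avg_iter m f (x * s)) (avg_iter m g (x * s)))).
- apply (RInt_plus (V := R_CompleteNormedModule) (fun s => avg_iter m f (x * s)) (fun s => avg_iter m g (x * s)));
  apply ex_RInt_avg with b; auto; now apply continuous_below_avg_iter.
- rewrite Rmin_left, Rmax_right by lra. intros s Hs. apply IHm.
  destruct (Rle_dec x 0); nra.
Qed.

Lemma avg_iter_scal (b : R) (m : nat) (c : R) (f : R -> R) :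
  0 < b -> continuous_below b f ->
  forall x, x < b ->
  avg_iter m (fun t => c * f t) x = c * avg_iter m f x.
Proof.
intros Hb Hf. induction m; intros x Hx; simpl; auto.
unfold avg at 1. rewrite (RInt_ext _ (fun s => scal c (avg_iter m f (x * s)))).
- apply (RInt_scal (V := R_CompleteNormedModule) (fun s => avg_iter m f (x * s)) 0 1 c).
  apply ex_RInt_avg with b; auto; now apply continuous_below_avg_iter.
- rewrite Rmin_left, Rmax_right by lra. intros s Hs. apply IHm.
  destruct (Rle_dec x 0); nra.
Qed.

Lemma avg_iter_bound (b : R) (m : nat) (f : R -> R) (M : R) :
  1 < b -> continuous_below b f ->
  (forall t, 0 <= t <= 1 -> Rabs (f t) <= M) ->
  forall x, 0 <= x <= 1 -> Rabs (avg_iter m f x) <= M.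
Proof.
intros Hb Hf HM. induction m; intros x Hx; simpl; auto.
unfold avg. replace M with ((1 - 0) * M) by ring.
apply abs_RInt_le_const; [lra| |].
- apply ex_RInt_avg with b; try lra. apply continuous_below_avg_iter; auto; lra.
- intros t Ht. apply IHm. nra.
Qed.

(** One average divides the coefficient of x^n by n + 1, so the iterated average
    at 1 is the functional with moments 1/(n+1)^m. *)
Lemma avg_iter_pow (m n : nat) (x : R) :
  avg_iter m (fun t => t ^ n) x = x ^ n / INR (S n) ^ m.
Proof.
assert (Hn : INR (S n) <> 0) by (apply not_0_INR; lia).
revert x. induction m; intros x.
- simpl. field.
- simpl avg_iter. unfold avg.
  rewrite (RInt_ext _ (fun s => scal (x ^ n / INR (S n) ^ m) (s ^ n))).
  + apply is_RInt_unique.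
    replace (x ^ n / INR (S n) ^ S m)
      with (scal (x ^ n / INR (S n) ^ m) (minus (/ INR (S n) * 1 ^ S n) (/ INR (S n) * 0 ^ S n))).
    * apply (is_RInt_scal (fun s => s ^ n)).
      apply (is_RInt_derive (fun s => / INR (S n) * s ^ S n)).
      -- intros s _. auto_derive; auto.
         change (match n with O => 1 | S _ => INR n + 1 end) with (INR (S n)).
         simpl Nat.pred. field. exact Hn.
      -- intros s _. apply (ex_derive_continuous (fun s => s ^ n)).
         auto_derive; auto.
    * change (x ^ n / INR (S n) ^ m * (/ INR (S n) * 1 ^ S n - / INR (S n) * 0 ^ S n)
        = x ^ n / INR (S n) ^ S m).
      rewrite pow1, pow_i by lia. rewrite <- (tech_pow_Rmult (INR (S n))).
      field. split; auto. now apply pow_nonzero.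
  + intros s _. rewrite IHm, Rpow_mult_distr.
    change (x ^ n * s ^ n / INR (S n) ^ m = x ^ n / INR (S n) ^ m * s ^ n).
    unfold Rdiv; ring.
Qed.

(** * Power series on the unit interval *)

Definition unit_series (a : nat -> R) (f : R -> R) : Prop :=
  forall x, Rabs x < 1 -> is_series (fun n => a n * x ^ n) (f x).

(** Terms of a convergent series tend to 0, which fails outside the disk of
    convergence. *)
Lemma CV_radius_ge (a : nat -> R) (r : R) :
  ex_series (fun n => a n * r ^ n) -> Rbar_le (Rabs r) (CV_radius a).
Proof.
intros H. apply Rbar_not_lt_le. intros Hlt.
apply CV_disk_outside in Hlt. now apply Hlt, ex_series_lim_0.
Qed.

Lemma unit_series_radius (a : nat -> R) (f : R -> R) (x : R) :
  unit_series a f -> Rabs x < 1 -> Rbar_lt (Rabs x) (CV_radius a).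
Proof.
intros Ha Hx. assert (Hr0 : 0 <= Rabs x) by apply Rabs_pos.
apply Rbar_lt_le_trans with (Finite (Rabs ((Rabs x + 1) / 2))).
- simpl. rewrite (Rabs_pos_eq ((Rabs x + 1) / 2)); lra.
- apply CV_radius_ge. eexists. apply Ha. rewrite Rabs_pos_eq; lra.
Qed.

(** The series of int_0^x f has coefficients a_n / (n+1) shifted by one, and
    dividing by x shifts them back; at x = 0 both sides are the constant
    coefficient. *)
Lemma unit_series_avg (a : nat -> R) (f : R -> R) :
  continuous_below 1 f -> unit_series a f ->
  unit_series (fun n => a n / INR (S n)) (avg f).
Proof.
intros Hf Ha x Hx.
assert (Hx1 : -1 < x < 1) by (apply Rabs_def2 in Hx; lra).
apply (proj1 (is_pseries_R (fun n => a n / INR (S n)) x (avg f x))).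
destruct (Req_dec x 0) as [->|Hx0].
- rewrite avg_0. assert (E : f 0 = a 0%nat / INR 1).
  { rewrite <- (is_pseries_unique a 0 (f 0)).
    rewrite PSeries_0. simpl; field.
    apply is_pseries_R, Ha. exact Hx. }
  rewrite E. apply (is_pseries_0 (K := R_AbsRing) (V := R_NormedModule)
    (fun n => a n / INR (S n))).
- assert (H := is_pseries_RInt a x (unit_series_radius a f x Ha Hx)).
  apply (is_pseries_decr_1 _ x (/ x)) in H;
    [|change (/ x * x = 1); field; exact Hx0].
  rewrite (RInt_ext _ f) in H.
  + rewrite <- (avg_mul_eq 1 f x) in H by (auto; lra).
    match type of H with is_pseries _ _ ?v => replace v with (avg f x) in H end.
    exact H.
    change (avg f x = / x * (x * avg f x + - 0)). field; exact Hx0.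
  + intros t Ht. apply is_pseries_unique, is_pseries_R, Ha.
    apply Rabs_def1; unfold Rmin, Rmax in Ht; destruct (Rle_dec 0 x); lra.
Qed.

Lemma unit_series_avg_iter (a : nat -> R) (f : R -> R) (m : nat) :
  continuous_below 1 f -> unit_series a f ->
  unit_series (fun n => a n / INR (S n) ^ m) (avg_iter m f).
Proof.
intros Hf Ha. induction m.
- intros x Hx. eapply is_series_ext; [|apply Ha; exact Hx].
  intros n; simpl. real_eq. field.
- intros x Hx. eapply is_series_ext; [|apply (unit_series_avg _ _ (continuous_below_avg_iter 1 f m Rlt_0_1 Hf) IHm x Hx)].
  intros n. cbv beta. assert (INR (S n) <> 0) by (apply not_0_INR; lia).
  rewrite <- (tech_pow_Rmult (INR (S n))). real_eq. field.
  split; auto. now apply pow_nonzero.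
Qed.

Lemma is_series_partial_le (a : nat -> R) (l : R) (n : nat) :
  (forall k, 0 <= a k) -> is_series a l -> sum_n a n <= l.
Proof.
intros Ha Hl.
apply (is_lim_seq_incr_compare (sum_n a)).
- exact Hl.
- intros k. rewrite sum_Sn. change (sum_n a k <= sum_n a k + a (S k)).
  specialize (Ha (S k)); lra.
Qed.

Lemma is_series_le (a b : nat -> R) (la lb : R) :
  (forall n, a n <= b n) -> is_series a la -> is_series b lb -> la <= lb.
Proof.
intros H Ha Hb.
apply (is_lim_seq_le (sum_n a) (sum_n b) la lb); [|exact Ha|exact Hb].
intros n. induction n. rewrite !sum_O. apply H.
rewrite !sum_Sn. apply Rplus_le_compat; auto.
Qed.

(** Abel's limit theorem.  With nonnegative coefficients no summation by parts is
    needed: f x is at most l, and at least a partial sum, which near x = 1 is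
    close to a partial sum of the numbers a_n. *)
Lemma unit_series_abel (a : nat -> R) (f : R -> R) (l : R) :
  (forall n, 0 <= a n) -> unit_series a f -> is_series a l ->
  filterlim f (at_left 1) (locally l).
Proof.
intros Ha Hf Hl.
apply (filterlim_locally f l). intros eps.
assert (HN : exists N, l - eps / 2 < sum_n a N).
{ assert (H : is_lim_seq (sum_n a) l) by exact Hl. apply is_lim_seq_spec in H.
  destruct (H (pos_div_2 eps)) as [N HN]. exists N.
  specialize (HN N (le_n N)). change (Rabs (sum_n a N - l) < eps / 2) in HN.
  apply Rabs_def2 in HN. lra. }
destruct HN as [N HN].
assert (Hc : continuous (fun x => sum_n (fun n => a n * x ^ n) N) 1).
{ clear HN. induction N.
  - apply (continuous_ext (fun x => a 0%nat * x ^ 0)).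
    intros x. now rewrite sum_O.
    apply (ex_derive_continuous (fun x => a 0%nat * x ^ 0)). auto_derive; auto.
  - apply (continuous_ext (fun x => plus (sum_n (fun n => a n * x ^ n) N) (a (S N) * x ^ (S N)))).
    intros x. now rewrite sum_Sn.
    apply (continuous_plus (fun x => sum_n (fun n => a n * x ^ n) N)
       (fun x => a (S N) * x ^ S N)). exact IHN.
    apply (ex_derive_continuous (fun x => a (S N) * x ^ S N)). auto_derive; auto. }
destruct (proj1 (filterlim_locally _ _) Hc (pos_div_2 eps)) as [d Hd].
assert (Hm : 0 < Rmin d 1) by (apply Rmin_pos; [apply cond_pos|lra]).
exists (mkposreal _ Hm). intros x Hx Hx1.
change (Rabs (x - 1) < Rmin d 1) in Hx.
assert (Hxd : Rabs (x - 1) < d) by (eapply Rlt_le_trans; [exact Hx|apply Rmin_l]).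
assert (Hx2 : Rabs (x - 1) < 1) by (eapply Rlt_le_trans; [exact Hx|apply Rmin_r]).
apply Rabs_def2 in Hx2.
assert (Hs := Hf x ltac:(apply Rabs_def1; lra)).
assert (Hpow : forall n, 0 <= x ^ n <= 1).
{ intros n; split. apply pow_le; lra. rewrite <- (pow1 n). apply pow_incr; lra. }
specialize (Hd x Hxd).
change (Rabs (sum_n (fun n => a n * x ^ n) N - sum_n (fun n => a n * 1 ^ n) N) < eps / 2) in Hd.
rewrite (sum_n_ext (fun n => a n * 1 ^ n) a) in Hd
  by (intros n; rewrite pow1; apply Rmult_1_r).
apply Rabs_def2 in Hd.
assert (H1 : sum_n (fun n => a n * x ^ n) N <= f x).
{ apply is_series_partial_le; auto. intros k. specialize (Hpow k). specialize (Ha k). nra. }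
assert (H2 : f x <= l).
{ apply is_series_le with (2 := Hs) (3 := Hl). intros n. specialize (Hpow n). specialize (Ha n). nra. }
change (Rabs (f x - l) < eps). apply Rabs_def1; lra.
Qed.

(** From 1 - x^n <= n (1 - x): a convergent first moment makes the convergence
    at 1 linear, enough to absorb a factor ln (1 - x). *)
Lemma unit_series_abel_rate (a : nat -> R) (f : R -> R) (l l' x : R) :
  (forall n, 0 <= a n) -> unit_series a f -> is_series a l ->
  is_series (fun n => INR n * a n) l' ->
  0 <= x < 1 -> 0 <= l - f x <= (1 - x) * l'.
Proof.
intros Ha Hf Hl Hl' Hx.
assert (Hs := Hf x ltac:(apply Rabs_def1; lra)).
assert (Hpow : forall n, 0 <= 1 - x ^ n <= INR n * (1 - x)).
{ induction n.
  - simpl; lra.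
  - rewrite S_INR. simpl pow.
    assert (0 <= x ^ n) by (apply pow_le; lra).
    assert (0 <= INR n) by apply pos_INR. nra. }
assert (Hd : is_series (fun n => a n - a n * x ^ n) (l - f x)).
{ apply (is_series_minus _ _ _ _ Hl Hs). }
split.
- enough (f x <= l) by lra. apply is_series_le with (2 := Hs) (3 := Hl).
  intros n. specialize (Hpow n). specialize (Ha n). nra.
- apply (is_series_le (fun n => a n - a n * x ^ n)
    (fun n => scal (1 - x) (INR n * a n))); [|exact Hd|].
  + intros n. specialize (Hpow n). specialize (Ha n).
    change (a n - a n * x ^ n <= (1 - x) * (INR n * a n)). nra.
  + apply (is_series_scal (K := R_AbsRing) (1 - x) _ l' Hl').
Qed.

(** * Polylogarithms on the half-line below 1 *)

Definition geom (x : R) : R := / (1 - x).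
Definition log_geom (x : R) : R := - ln (1 - x) / (1 - x).

Definition polylog (m : nat) (x : R) : R := x * avg_iter m geom x.
(** S_(m,2).  Since ln(1-x)^2 / 2 is the primitive of [log_geom], it is
    S_(0,2), one average more than the polylogarithm of the same index. *)
Definition nielsen2 (m : nat) (x : R) : R := x * avg_iter (S m) log_geom x.

Lemma continuous_below_geom : continuous_below 1 geom.
Proof.
intros x Hx. apply (ex_derive_continuous geom). unfold geom.
auto_derive. lra.
Qed.

Lemma continuous_below_log_geom : continuous_below 1 log_geom.
Proof.
intros x Hx. apply (ex_derive_continuous log_geom). unfold log_geom.
auto_derive. repeat split; lra.
Qed.

(** Identifies the lowest members of the two families. *)
Lemma mul_avg_eq_primitive (f F : R -> R) (x : R) :
  continuous_below 1 f -> x < 1 ->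
  (forall y, y < 1 -> is_derive F y (f y)) -> F 0 = 0 ->
  x * avg f x = F x.
Proof.
intros Hf Hx HF HF0. rewrite (avg_mul_eq 1) by (auto; lra).
apply is_RInt_unique.
replace (F x) with (minus (F x) (F 0))
  by (rewrite HF0; change (F x - 0 = F x); ring).
apply (is_RInt_derive F f); intros y Hy;
  assert (y < 1) by (unfold Rmax in Hy; destruct (Rle_dec 0 x); lra); auto.
Qed.

Lemma polylog_1 (x : R) : x < 1 -> polylog 1 x = - ln (1 - x).
Proof.
intros Hx.
apply (mul_avg_eq_primitive geom (fun y => - ln (1 - y)) x); auto.
- apply continuous_below_geom.
- intros y Hy. unfold geom. auto_derive. lra. field; lra.
- rewrite Rminus_0_r, ln_1. ring.
Qed.

Lemma nielsen2_0 (x : R) : x < 1 -> nielsen2 0 x = ln (1 - x) ^ 2 / 2.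
Proof.
intros Hx.
apply (mul_avg_eq_primitive log_geom (fun y => ln (1 - y) ^ 2 / 2) x); auto.
- apply continuous_below_log_geom.
- intros y Hy. unfold log_geom. auto_derive. lra. change (1 + - y) with (1 - y). field; lra.
- rewrite Rminus_0_r, ln_1. simpl; field.
Qed.

Lemma is_derive_polylog (m : nat) (x : R) :
  x < 1 -> x <> 0 -> is_derive (polylog (S m)) x (polylog m x / x).
Proof.
intros Hx Hx0. replace (polylog m x / x) with (avg_iter m geom x).
- apply (is_derive_mul_avg_iter 1); auto using continuous_below_geom; lra.
- unfold polylog. field; exact Hx0.
Qed.

Lemma is_derive_nielsen2 (m : nat) (x : R) :
  x < 1 -> x <> 0 -> is_derive (nielsen2 (S m)) x (nielsen2 m x / x).
Proof.
intros Hx Hx0. replace (nielsen2 m x / x) with (avg_iter (S m) log_geom x).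
- apply (is_derive_mul_avg_iter 1 log_geom (S m)); auto using continuous_below_log_geom; lra.
- unfold nielsen2. field; exact Hx0.
Qed.

Lemma polylog_0_r (m : nat) : polylog m 0 = 0.
Proof. apply Rmult_0_l. Qed.

Lemma nielsen2_0_r (m : nat) : nielsen2 m 0 = 0.
Proof. apply Rmult_0_l. Qed.

Lemma continuous_polylog (m : nat) (x : R) : x < 1 -> continuous (polylog m) x.
Proof.
intros Hx. apply (continuous_mult (fun y => y) (avg_iter m geom)).
apply continuous_id.
apply (continuous_below_avg_iter 1); auto using continuous_below_geom; lra.
Qed.

Lemma continuous_nielsen2 (m : nat) (x : R) : x < 1 -> continuous (nielsen2 m) x.
Proof.
intros Hx. apply (continuous_mult (fun y => y) (avg_iter (S m) log_geom)).
apply continuous_id.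
apply (continuous_below_avg_iter 1); auto using continuous_below_log_geom; lra.
Qed.

Fixpoint harmonic (n : nat) : R :=
  match n with O => 0 | S k => harmonic k + / INR (S k) end.

Lemma unit_series_geom : unit_series (fun _ => 1) geom.
Proof.
intros x Hx. eapply is_series_ext; [|apply is_series_geom; exact Hx].
intros n. symmetry; apply Rmult_1_l.
Qed.

Definition inv_seq (n : nat) : R := match n with O => 0 | S _ => / INR n end.

(** The Cauchy product of - ln (1 - x) with 1/(1 - x) turns the coefficients 1/n
    into their partial sums. *)
Lemma harmonic_convolution (n : nat) :
  PS_mult inv_seq (fun _ => 1) n = harmonic n.
Proof.
unfold PS_mult. induction n.
- simpl; ring.
- rewrite tech5. change (sum_f_R0 (fun k => inv_seq k * 1) n = harmonic n) in IHn.
  change (sum_f_R0 (fun k => inv_seq k * 1) n + inv_seq (S n) * 1 = harmonic (S n)).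
  rewrite IHn. change (harmonic (S n)) with (harmonic n + / INR (S n)). unfold inv_seq. ring.
Qed.

Lemma unit_series_log_geom : unit_series harmonic log_geom.
Proof.
assert (Hu : unit_series inv_seq (fun x => - ln (1 - x))).
{ intros x Hx.
  assert (Hx1 : x < 1) by (apply Rabs_def2 in Hx; lra).
  assert (H := unit_series_avg _ _ continuous_below_geom unit_series_geom x Hx).
  apply (is_pseries_R (fun n => 1 / INR (S n))) in H.
  apply is_pseries_incr_1 in H. apply (proj1 (is_pseries_R inv_seq x _)).
  rewrite <- polylog_1 by exact Hx1.
  eapply is_pseries_ext; [|exact H].
  intros [|n]; simpl PS_incr_1; unfold inv_seq; auto.
  unfold Rdiv. now rewrite Rmult_1_l. }
intros x Hx. apply (proj1 (is_pseries_R harmonic x _)).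
apply (is_pseries_ext (PS_mult inv_seq (fun _ => 1))).
apply harmonic_convolution.
apply is_pseries_mult.
- apply (proj2 (is_pseries_R inv_seq x _)). now apply Hu.
- apply (proj2 (is_pseries_R (fun _ => 1) x _)). now apply unit_series_geom.
- now apply unit_series_radius with (1 := Hu).
- now apply unit_series_radius with (1 := unit_series_geom).
Qed.

(** * Limits and derivatives *)

Definition tends (F : (R -> Prop) -> Prop) (f : R -> R) (l : R) : Prop :=
  filterlim f F (locally l).

Lemma tends_plus (F : (R -> Prop) -> Prop) {FF : Filter F} (f g : R -> R) (a b : R) :
  tends F f a -> tends F g b -> tends F (fun x => f x + g x) (a + b).
Proof.
intros Hf Hg. apply (filterlim_comp_2 (G := locally a) (H := locally b) f g Rplus Hf Hg).
apply (filterlim_plus (K := R_AbsRing) (V := R_NormedModule) a b).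
Qed.

Lemma tends_mult (F : (R -> Prop) -> Prop) {FF : Filter F} (f g : R -> R) (a b : R) :
  tends F f a -> tends F g b -> tends F (fun x => f x * g x) (a * b).
Proof.
intros Hf Hg. apply (filterlim_comp_2 (G := locally a) (H := locally b) f g Rmult Hf Hg).
apply (filterlim_mult (K := R_AbsRing) a b).
Qed.

Lemma tends_const (F : (R -> Prop) -> Prop) {FF : Filter F} (a : R) :
  tends F (fun _ => a) a.
Proof. apply filterlim_const. Qed.

Lemma tends_squeeze (F : (R -> Prop) -> Prop) {FF : Filter F} (f g : R -> R) (a : R) :
  F (fun x => Rabs (f x - a) <= g x) -> tends F g 0 -> tends F f a.
Proof.
intros H Hg. apply (filterlim_locally f a). intros eps.
assert (Hg' := proj1 (filterlim_locally g 0) Hg eps).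
generalize (filter_and _ _ H Hg'). apply filter_imp. intros x [H1 H2].
change (Rabs (g x - 0) < eps) in H2. change (Rabs (f x - a) < eps).
apply Rabs_def2 in H2. lra.
Qed.

Lemma tends_right_of_continuous (f : R -> R) (a : R) :
  continuous f a -> tends (at_right a) f (f a).
Proof.
intros H. eapply filterlim_filter_le_1; [|exact H].
intros P HP. unfold at_right, within. generalize HP. apply filter_imp. auto.
Qed.

Lemma tends_left_of_continuous (f : R -> R) (a : R) :
  continuous f a -> tends (at_left a) f (f a).
Proof.
intros H. eapply filterlim_filter_le_1; [|exact H].
intros P HP. unfold at_left, within. generalize HP. apply filter_imp. auto.
Qed.

Lemma at_right_of_interval (a b : R) (P : R -> Prop) :
  a < b -> (forall t, a < t < b -> P t) -> at_right a P.
Proof.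
intros H HP. exists (mkposreal (b - a) ltac:(lra)). intros y Hy Hy'.
change (Rabs (y - a) < b - a) in Hy. apply Rabs_def2 in Hy. apply HP. lra.
Qed.

Lemma at_left_of_interval (a b : R) (P : R -> Prop) :
  a < b -> (forall t, a < t < b -> P t) -> at_left b P.
Proof.
intros H HP. exists (mkposreal (b - a) ltac:(lra)). intros y Hy Hy'.
change (Rabs (y - b) < b - a) in Hy. apply Rabs_def2 in Hy. apply HP. lra.
Qed.

Lemma ln_le_sub_1 (x : R) : 0 < x -> ln x <= x - 1.
Proof.
intros Hx. assert (H := exp_ineq1_le (ln x)). rewrite exp_ln in H; lra.
Qed.

(** With u the fourth root of t, ln t = 4 ln u and - u ln u <= 1. *)
Lemma mul_ln_sq_bound (t : R) : 0 < t < 1 -> 0 <= t * ln t ^ 2 <= 16 * sqrt t.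
Proof.
intros Ht. split.
- apply Rmult_le_pos; [lra|apply pow2_ge_0].
- set (v := sqrt t). assert (Hv : 0 < v) by (apply sqrt_lt_R0; lra).
  set (u := sqrt v). assert (Hu : 0 < u) by (apply sqrt_lt_R0; lra).
  assert (Ev : v = u * u) by (symmetry; apply sqrt_sqrt; lra).
  assert (Et : t = v * v) by (symmetry; apply sqrt_sqrt; lra).
  assert (Eln : ln t = 4 * ln u).
  { rewrite Et, Ev, !ln_mult by nra. ring. }
  assert (Hl : ln t < 0) by (rewrite <- ln_1; apply ln_increasing; lra).
  assert (Hi := ln_le_sub_1 (/ u) (Rinv_0_lt_compat _ Hu)).
  rewrite ln_Rinv in Hi by exact Hu.
  assert (H1 : - (u * ln u) <= 1).
  { apply (Rmult_le_compat_l u) in Hi; [|lra].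
    replace (u * (/ u - 1)) with (1 - u) in Hi by (field; lra). lra. }
  rewrite Eln, Et, Ev. rewrite Eln in Hl.
  replace (u * u * (u * u) * (4 * ln u) ^ 2) with (16 * (u * u) * (- (u * ln u) * - (u * ln u))) by ring.
  assert (0 <= - (u * ln u)) by nra.
  assert (- (u * ln u) * - (u * ln u) <= 1) by nra. nra.
Qed.

Lemma tends_mul_ln_sq : tends (at_right 0) (fun t => t * ln t ^ 2) 0.
Proof.
apply (tends_squeeze (at_right 0) _ (fun t => 16 * sqrt t)).
- apply (at_right_of_interval 0 1); [lra|]. intros t Ht.
  destruct (mul_ln_sq_bound t Ht). rewrite Rabs_pos_eq; lra.
- replace 0 with (16 * sqrt 0) at 2 by (rewrite sqrt_0; ring).
  apply (tends_right_of_continuous (fun t => 16 * sqrt t)).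
  apply (continuous_mult (fun _ => 16) sqrt). apply continuous_const.
  apply continuity_pt_filterlim, continuity_pt_sqrt. lra.
Qed.

Lemma tends_mul_ln : tends (at_right 0) (fun t => t * ln t) 0.
Proof.
apply (tends_squeeze (at_right 0) _ (fun t => t + t * ln t ^ 2)).
- apply (at_right_of_interval 0 1); [lra|]. intros t Ht.
  rewrite Rminus_0_r, Rabs_mult, (Rabs_pos_eq t) by lra.
  assert (H := pow2_abs (ln t)). set (y := Rabs (ln t)) in *. rewrite <- H.
  assert (y <= 1 + y ^ 2) by nra. nra.
- replace 0 with (0 + 0) at 2 by ring.
  apply (tends_plus (at_right 0)).
  apply (tends_right_of_continuous (fun t => t)). apply continuous_id.
  apply tends_mul_ln_sq.
Qed.

Lemma is_derive_Rplus (f g : R -> R) (x df dg : R) :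
  is_derive f x df -> is_derive g x dg ->
  is_derive (fun t => f t + g t) x (df + dg).
Proof. exact (is_derive_plus (K := R_AbsRing) (V := R_NormedModule) f g x df dg). Qed.

Lemma is_derive_Rmult (f g : R -> R) (x df dg : R) :
  is_derive f x df -> is_derive g x dg ->
  is_derive (fun t => f t * g t) x (df * g x + f x * dg).
Proof.
intros Hf Hg.
exact (is_derive_mult (K := R_AbsRing) f g x df dg Hf Hg Rmult_comm).
Qed.

Lemma is_derive_Rscal (c : R) (f : R -> R) (x df : R) :
  is_derive f x df -> is_derive (fun t => c * f t) x (c * df).
Proof. exact (is_derive_scal f x c df). Qed.

Lemma is_derive_Rconst (c x : R) : is_derive (fun _ : R => c) x 0.
Proof. exact (is_derive_const c x). Qed.

Lemma is_derive_Rminus (f g : R -> R) (x df dg : R) :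
  is_derive f x df -> is_derive g x dg ->
  is_derive (fun t => f t - g t) x (df - dg).
Proof. exact (is_derive_minus (K := R_AbsRing) (V := R_NormedModule) f g x df dg). Qed.

Lemma is_derive_value (f : R -> R) (x d d' : R) :
  is_derive f x d -> d = d' -> is_derive f x d'.
Proof. now intros H <-. Qed.

Lemma is_derive_Rcomp (f g : R -> R) (x df dg : R) :
  is_derive f (g x) df -> is_derive g x dg ->
  is_derive (fun t => f (g t)) x (dg * df).
Proof. intros Hf Hg. exact (is_derive_comp f g x df dg Hf Hg). Qed.

(** * The Nielsen integral *)

Lemma Clog_pos (t : R) : 0 < t -> Clog (RtoC t) = RtoC (ln t).
Proof.
intros Ht. unfold Clog, Carg. simpl Im. simpl Re.
rewrite Cmod_R, Rabs_pos_eq by lra.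
replace (t / t) with 1 by (field; lra). rewrite acos_1.
destruct (Rle_dec 0 0); [reflexivity|lra].
Qed.

Lemma is_derive_nielsen2_scale (m : nat) (x t : R) :
  x * t < 1 -> 0 < t ->
  is_derive (fun t => nielsen2 (S m) (x * t)) t (nielsen2 m (x * t) / t).
Proof.
intros H Ht.
replace (nielsen2 m (x * t) / t) with (scal x (avg_iter (S m) log_geom (x * t))).
- apply (is_derive_comp (nielsen2 (S m)) (fun t => x * t)).
  + apply (is_derive_mul_avg_iter 1 log_geom (S m)); auto using continuous_below_log_geom; lra.
  + auto_derive; auto. ring.
- unfold nielsen2. change (x * avg_iter (S m) log_geom (x * t) =
    x * t * avg_iter (S m) log_geom (x * t) / t). field. lra.
Qed.

(** Obtained from ln(t)^2 ln(1 - x t)^2 / t by integrating by parts twice, each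
    time differentiating the power of ln t. *)
Definition nielsen_primitive (x t : R) : R :=
  2 * ln t ^ 2 * nielsen2 1 (x * t) - 4 * ln t * nielsen2 2 (x * t)
  + 4 * nielsen2 3 (x * t).

Lemma mul_lt_1 (x t : R) : x < 1 -> 0 <= t <= 1 -> x * t < 1.
Proof. intros. destruct (Rle_dec x 0); nra. Qed.

Lemma is_derive_nielsen_primitive (x t : R) :
  x < 1 -> 0 < t <= 1 ->
  is_derive (nielsen_primitive x) t (ln t ^ 2 * ln (1 - x * t) ^ 2 / t).
Proof.
intros Hx Ht.
assert (Hxt : x * t < 1) by (apply mul_lt_1; lra).
assert (D1 := is_derive_nielsen2_scale 0 x t Hxt (proj1 Ht)).
assert (D2 := is_derive_nielsen2_scale 1 x t Hxt (proj1 Ht)).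
assert (D3 := is_derive_nielsen2_scale 2 x t Hxt (proj1 Ht)).
rewrite nielsen2_0 in D1 by exact Hxt.
assert (Dl : is_derive (fun t => 2 * ln t ^ 2) t (4 * ln t / t)).
{ auto_derive. lra. field; lra. }
assert (Dm : is_derive (fun t => - 4 * ln t) t (- 4 / t)).
{ auto_derive. lra. field; lra. }
unfold nielsen_primitive.
apply (is_derive_ext (fun t => 2 * ln t ^ 2 * nielsen2 1 (x * t)
   + - 4 * ln t * nielsen2 2 (x * t) + 4 * nielsen2 3 (x * t))).
{ intros u. real_eq. ring. }
replace (ln t ^ 2 * ln (1 - x * t) ^ 2 / t) with
  (4 * ln t / t * nielsen2 1 (x * t) + 2 * ln t ^ 2 * (ln (1 - x * t) ^ 2 / 2 / t)
   + (- 4 / t * nielsen2 2 (x * t) + - 4 * ln t * (nielsen2 1 (x * t) / t))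
   + 4 * (nielsen2 2 (x * t) / t)) by (field; lra).
exact (is_derive_Rplus _ _ _ _ _
  (is_derive_Rplus _ _ _ _ _ (is_derive_Rmult _ _ _ _ _ Dl D1)
    (is_derive_Rmult _ _ _ _ _ Dm D2))
  (is_derive_Rscal 4 _ _ _ D3)).
Qed.

(** S_(k,2)(x t) is t times a continuous function, and t beats ln(t)^2. *)
Lemma tends_nielsen_primitive (x : R) : tends (at_right 0) (nielsen_primitive x) 0.
Proof.
assert (Hc : forall m, tends (at_right 0) (fun t => x * avg_iter (S m) log_geom (x * t))
   (x * avg_iter (S m) log_geom (x * 0))).
{ intros m. apply (tends_right_of_continuous (fun t => x * avg_iter (S m) log_geom (x * t))).
  apply (continuous_mult (fun _ => x) (fun t => avg_iter (S m) log_geom (x * t))).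
  apply continuous_const.
  apply (continuous_comp (fun t => x * t) (avg_iter (S m) log_geom)).
  apply (continuous_mult (fun _ => x) (fun t => t)).
  apply continuous_const. apply continuous_id.
  apply (continuous_below_avg_iter 1); auto using continuous_below_log_geom; lra. }
set (c := fun m => x * avg_iter (S m) log_geom (x * 0)) in *.
replace 0 with (2 * 0 * c 1%nat + - 4 * 0 * c 2%nat + 4 * (0 * c 3%nat)) at 2 by ring.
apply (filterlim_ext (fun t =>
  2 * (t * ln t ^ 2) * (x * avg_iter 2 log_geom (x * t)) +
  - 4 * (t * ln t) * (x * avg_iter 3 log_geom (x * t)) +
  4 * (t * (x * avg_iter 4 log_geom (x * t))))).
{ intros t. unfold nielsen_primitive, nielsen2. real_eq. ring. }
assert (Hid : tends (at_right 0) (fun t => t) 0)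
  by apply (tends_right_of_continuous (fun t => t)), continuous_id.
exact (tends_plus _ _ _ _ _
  (tends_plus _ _ _ _ _
    (tends_mult _ _ _ _ _
      (tends_mult _ _ _ _ _ (tends_const _ 2) tends_mul_ln_sq) (Hc 1%nat))
    (tends_mult _ _ _ _ _
      (tends_mult _ _ _ _ _ (tends_const _ (- 4)) tends_mul_ln) (Hc 2%nat)))
  (tends_mult _ _ _ _ _ (tends_const _ 4) (tends_mult _ _ _ _ _ Hid (Hc 3%nat)))).
Qed.

(** On (0, 1) both t and 1 - x t are positive, so the logarithms are real.  The
    primitive vanishes at 0, and at t = 1 only its term without ln t survives. *)
Lemma nielsen_3_2_real (x : R) :
  x < 1 -> nielsen 3 2 (RtoC x) = RtoC (nielsen2 3 x).
Proof.
intros Hx. unfold nielsen. simpl Nat.sub.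
set (F := fun t : R => _).
assert (HF : forall t, 0 < t <= 1 -> F t = RtoC (ln t ^ 2 * ln (1 - x * t) ^ 2 / t)).
{ intros t Ht. unfold F.
  rewrite <- RtoC_mult, <- RtoC_minus.
  assert (x * t < 1) by (apply mul_lt_1; lra).
  rewrite !Clog_pos, <- !RtoC_pow, <- RtoC_mult, <- RtoC_div by lra. reflexivity. }
assert (HI : is_RInt_gen (V := C_R_CompleteNormedModule) F (at_right 0) (at_point 1)
   (RtoC (4 * nielsen2 3 x))).
{ intros P [eps HP]. unfold filtermapi.
  assert (Hl := proj1 (filterlim_locally (nielsen_primitive x) 0)
     (tends_nielsen_primitive x) eps).
  apply (Filter_prod (at_right 0) (at_point 1) _
    (fun a => 0 < a < 1 /\ ball 0 eps (nielsen_primitive x a)) (fun b => b = 1)).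
  - apply filter_and; [apply (at_right_of_interval 0 1); [lra|auto]|exact Hl].
  - reflexivity.
  - intros a b [Ha Hb] ->. simpl fst; simpl snd.
    exists (RtoC (nielsen_primitive x 1 - nielsen_primitive x a)). split.
    + apply (is_RInt_ext (V := C_R_NormedModule)
        (fun t => RtoC (ln t ^ 2 * ln (1 - x * t) ^ 2 / t))).
      { rewrite Rmin_left, Rmax_right by lra. intros t Ht. symmetry. apply HF. lra. }
      apply (is_RInt_fct_extend_pair (U := R_NormedModule) (V := R_NormedModule)
        (fun t => RtoC (ln t ^ 2 * ln (1 - x * t) ^ 2 / t))).
      * simpl fst. apply (is_RInt_derive (nielsen_primitive x)).
        -- rewrite Rmin_left, Rmax_right by lra. intros t Ht.
           apply is_derive_nielsen_primitive; lra.
        -- rewrite Rmin_left, Rmax_right by lra. intros t Ht.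
           assert (x * t < 1) by (apply mul_lt_1; lra).
           apply (ex_derive_continuous (fun t => ln t ^ 2 * ln (1 - x * t) ^ 2 / t)).
           auto_derive. repeat split; lra.
      * assert (Hz := is_RInt_const (V := R_NormedModule) a 1 0).
        change (scal (1 - a) 0) with ((1 - a) * 0) in Hz. rewrite Rmult_0_r in Hz.
        exact Hz.
    + apply HP. split; [|apply ball_center].
      change (Rabs (nielsen_primitive x a - 0) < eps) in Hb.
      change (Rabs (nielsen_primitive x 1 - nielsen_primitive x a - 4 * nielsen2 3 x) < eps).
      unfold nielsen_primitive at 1. rewrite ln_1, !Rmult_1_r.
      replace (2 * 0 ^ 2 * nielsen2 1 x - 4 * 0 * nielsen2 2 x + 4 * nielsen2 3 x
        - nielsen_primitive x a - 4 * nielsen2 3 x) with (- (nielsen_primitive x a - 0)) by ring.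
      now rewrite Rabs_Ropp. }
assert (E : RInt_gen (V := C_R_CompleteNormedModule) F (at_right 0) (at_point 1)
  = RtoC (4 * nielsen2 3 x)).
{ apply (is_RInt_gen_unique (V := C_R_CompleteNormedModule) (Fa := at_right 0) (Fb := at_point 1)
    (FFa := Proper_StrongProper _ (at_right_proper_filter 0))
    (FFb := Proper_StrongProper _ (at_point_filter 1))). exact HI. }
rewrite E, <- RtoC_mult. f_equal. simpl. field.
Qed.

(** * Double zeta values *)

(** The sum of the first M terms; the empty sum at M = 0 is what the strict
    inequality n < N in double zeta values calls for. *)
Fixpoint psum (f : nat -> R) (M : nat) : R :=
  match M with O => 0 | S k => psum f k + f k end.

(** With the index shifted by one, as in the definition of zeta. *)
Definition ipow (m n : nat) : R := / INR (S n) ^ m.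

Lemma psum_S (f : nat -> R) (n : nat) : psum f (S n) = sum_n f n.
Proof.
induction n. rewrite sum_O. simpl; ring.
rewrite sum_Sn, <- IHn. reflexivity.
Qed.

Lemma psum_ext (f g : nat -> R) (M : nat) :
  (forall k, (k < M)%nat -> f k = g k) -> psum f M = psum g M.
Proof.
induction M; intros H; simpl; auto. rewrite IHM, H; auto.
Qed.

Lemma psum_le (f g : nat -> R) (M : nat) :
  (forall k, (k < M)%nat -> f k <= g k) -> psum f M <= psum g M.
Proof.
induction M; intros H; simpl; [lra|]. apply Rplus_le_compat; auto.
Qed.

Lemma psum_plus (f g : nat -> R) (M : nat) :
  psum (fun k => f k + g k) M = psum f M + psum g M.
Proof. induction M; simpl; [ring|rewrite IHM; ring]. Qed.

Lemma psum_scal (c : R) (f : nat -> R) (M : nat) :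
  psum (fun k => c * f k) M = c * psum f M.
Proof. induction M; simpl; [ring|rewrite IHM; ring]. Qed.

Lemma psum_head (f : nat -> R) (M : nat) :
  psum f (S M) = f O + psum (fun k => f (S k)) M.
Proof.
induction M; [simpl; ring|].
change (psum f (S (S M))) with (psum f (S M) + f (S M)). rewrite IHM. simpl; ring.
Qed.

Lemma psum_rev (f : nat -> R) (M : nat) :
  psum (fun k => f (M - S k)%nat) M = psum f M.
Proof.
induction M; auto. rewrite psum_head. simpl psum at 2. rewrite <- IHM.
replace (S M - 1)%nat with M by lia.
rewrite (psum_ext _ (fun k => f (M - S k)%nat)). ring.
intros k _; f_equal; lia.
Qed.

(** Stuffle: a square of indices is its two strict triangles and its diagonal. *)
Lemma psum_mul (a b : nat -> R) (M : nat) :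
  psum a M * psum b M =
  psum (fun n => a n * psum b n) M + psum (fun n => b n * psum a n) M
  + psum (fun n => a n * b n) M.
Proof.
induction M; simpl; [ring|].
replace ((psum a M + a M) * (psum b M + b M)) with
 (psum a M * psum b M + a M * psum b M + b M * psum a M + a M * b M) by ring.
rewrite IHM. ring.
Qed.

Lemma is_series_psum (f : nat -> R) (l : R) :
  is_series f l <-> is_lim_seq (psum f) l.
Proof.
split; intros H.
- apply is_lim_seq_incr_1. apply is_lim_seq_ext with (sum_n f).
  intros n; symmetry; apply psum_S. exact H.
- apply is_lim_seq_incr_1 in H. apply is_lim_seq_ext with (v := sum_n f) in H.
  exact H. apply psum_S.
Qed.

Lemma psum_le_series (f : nat -> R) (l : R) (M : nat) :
  (forall k, 0 <= f k) -> is_series f l -> psum f M <= l.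
Proof.
intros Hf Hl. apply Rle_trans with (psum f (S M)).
- simpl. specialize (Hf M); lra.
- rewrite psum_S. now apply is_series_partial_le.
Qed.

Lemma INR_S_ge_1 (n : nat) : 1 <= INR (S n).
Proof. change 1 with (INR 1). apply le_INR. lia. Qed.

Lemma ipow_pos (m n : nat) : 0 < ipow m n.
Proof.
apply Rinv_0_lt_compat, pow_lt. assert (H := INR_S_ge_1 n); lra.
Qed.

Lemma ipow_le (m m' n : nat) : (m' <= m)%nat -> ipow m n <= ipow m' n.
Proof.
intros H. apply Rinv_le_contravar.
- apply pow_lt. assert (H' := INR_S_ge_1 n); lra.
- apply Rle_pow; auto. apply INR_S_ge_1.
Qed.

Lemma ipow_S (m n : nat) : ipow (S m) n = ipow m n / INR (S n).
Proof.
unfold ipow. rewrite <- tech_pow_Rmult. assert (H := INR_S_ge_1 n).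
field. split; [apply pow_nonzero|]; lra.
Qed.

(** Comparison with the telescoping sum of 1/n - 1/(n+1). *)
Lemma ex_series_ipow_2 : ex_series (ipow 2).
Proof.
destruct (ex_finite_lim_seq_incr (psum (ipow 2)) 2) as [l Hl].
- intros n. simpl. assert (H := ipow_pos 2 n). lra.
- assert (H : forall n, psum (ipow 2) (S n) <= 2 - / INR (S n)).
  { induction n.
    - unfold ipow; simpl. lra.
    - change (psum (ipow 2) (S (S n))) with (psum (ipow 2) (S n) + ipow 2 (S n)).
      eapply Rle_trans; [apply Rplus_le_compat_r, IHn|].
      unfold ipow. rewrite (S_INR (S n)). assert (H := INR_S_ge_1 n).
      set (x := INR (S n)) in *.
      enough (0 <= / x - / (x + 1) - / (x + 1) ^ 2) by lra.
      replace (/ x - / (x + 1) - / (x + 1) ^ 2) with (/ (x * (x + 1) ^ 2)) by (field; lra).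
      apply Rlt_le, Rinv_0_lt_compat. nra. }
  intros n. assert (H1 := H n). simpl in H1. assert (H2 := ipow_pos 2 n).
  assert (0 < / INR (S n)) by (apply Rinv_0_lt_compat; assert (H3 := INR_S_ge_1 n); lra).
  change (match n with O => 1 | S _ => INR n + 1 end) with (INR (S n)) in H1. lra.
- exists l. now apply is_series_psum.
Qed.

Definition zeta_nat (m : nat) : R := Series (ipow m).

Lemma ex_series_le_ipow (f : nat -> R) (c : R) :
  (forall n, 0 <= f n <= c * ipow 2 n) -> ex_series f.
Proof.
intros H. apply (ex_series_le (K := R_AbsRing) (V := R_CompleteNormedModule) f (fun n => c * ipow 2 n)).
- intros n. change (Rabs (f n) <= c * ipow 2 n). specialize (H n).
  rewrite Rabs_pos_eq; lra.
- apply (ex_series_scal c (ipow 2)), ex_series_ipow_2.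
Qed.

Lemma is_series_zeta_nat (m : nat) : (2 <= m)%nat -> is_series (ipow m) (zeta_nat m).
Proof.
intros Hm. apply Series_correct, (ex_series_le_ipow _ 1). intros n.
assert (H := ipow_pos m n). assert (H' := ipow_le m 2 n Hm). lra.
Qed.

Lemma zeta_eq_zeta_nat (m : nat) (s : R) : s = INR m -> zeta s = zeta_nat m.
Proof.
intros ->. apply Series_ext. intros n. unfold ipow.
rewrite Rpower_pow; auto. assert (H := INR_S_ge_1 n); lra.
Qed.

Lemma harmonic_psum (n : nat) : harmonic n = psum (ipow 1) n.
Proof.
induction n; auto. change (harmonic (S n)) with (harmonic n + / INR (S n)).
rewrite IHn. simpl psum. unfold ipow at 3. now rewrite pow_1.
Qed.

(** Any bound of smaller order than n would do to see that H_n / n tends to 0;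
    the square root needs only sqrt (n+1) - sqrt n >= 1 / (2 sqrt (n+1)). *)
Lemma harmonic_le (n : nat) : harmonic n <= 2 * sqrt (INR n).
Proof.
induction n. simpl. rewrite sqrt_0; lra.
change (harmonic (S n)) with (harmonic n + / INR (S n)).
eapply Rle_trans; [apply Rplus_le_compat_r, IHn|].
assert (H1 := INR_S_ge_1 n). assert (H0 := pos_INR n).
assert (E : INR (S n) = INR n + 1) by apply S_INR.
assert (Ha := sqrt_sqrt (INR (S n)) ltac:(lra)).
assert (Hb := sqrt_sqrt (INR n) H0).
assert (Hp := sqrt_pos (INR n)).
assert (Hab : sqrt (INR n) <= sqrt (INR (S n))) by (apply sqrt_le_1; lra).
assert (Hq : 1 <= sqrt (INR (S n))) by (rewrite <- sqrt_1; apply sqrt_le_1; lra).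
set (x := sqrt (INR n)) in *. set (y := sqrt (INR (S n))) in *.
rewrite <- Ha in *. rewrite <- Hb in E.
enough (/ (y * y) <= 2 * (y - x)) by lra.
apply Rmult_le_reg_l with (y * y); [nra|].
rewrite Rinv_r by nra.
assert (1 = (y - x) * (y + x)) by nra.
assert ((y - x) * (y + x) <= (y - x) * (2 * y)) by (apply Rmult_le_compat_l; lra).
nra.
Qed.

(** The part of the double zeta value zeta(a,b) = sum over N > k >= 1 of
    N^(-a) k^(-b) with N = n + 1. *)
Definition mzv_term (a b n : nat) : R := ipow a n * psum (ipow b) n.

Lemma psum_nonneg (f : nat -> R) (M : nat) : (forall k, 0 <= f k) -> 0 <= psum f M.
Proof. intros H. induction M; simpl; [lra|]. specialize (H M); lra. Qed.

Lemma psum_ipow_nonneg (b n : nat) : 0 <= psum (ipow b) n.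
Proof. apply psum_nonneg. intros k. assert (H := ipow_pos b k); lra. Qed.

Lemma psum_ipow_le (b n : nat) : psum (ipow b) n <= INR (S n).
Proof.
rewrite S_INR. induction n. simpl; lra.
rewrite S_INR. simpl psum. assert (ipow b n <= 1); [|lra].
assert (H := ipow_le b 0 n ltac:(lia)). unfold ipow in H at 2. rewrite pow_O, Rinv_1 in H. exact H.
Qed.

Lemma ex_series_mzv (a b : nat) :
  (2 <= a)%nat -> (2 <= b \/ 3 <= a)%nat -> ex_series (mzv_term a b).
Proof.
intros Ha [Hb|Ha'].
- apply (ex_series_le_ipow _ (zeta_nat b)). intros n. unfold mzv_term.
  assert (H1 := ipow_pos a n). assert (H2 := psum_ipow_nonneg b n).
  assert (H3 := ipow_le a 2 n Ha).
  assert (H4 : psum (ipow b) n <= zeta_nat b).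
  { apply psum_le_series. intros k. assert (H := ipow_pos b k); lra.
    now apply is_series_zeta_nat. }
  split. nra. rewrite Rmult_comm. apply Rmult_le_compat; lra.
- apply (ex_series_le_ipow _ 1). intros n. unfold mzv_term.
  assert (H1 := ipow_pos a n). assert (H2 := psum_ipow_nonneg b n).
  split. nra. rewrite Rmult_1_l.
  assert (H3 := ipow_le a 3 n Ha').
  assert (H4 := psum_ipow_le b n).
  apply Rle_trans with (ipow 3 n * INR (S n)).
  + apply Rmult_le_compat; lra.
  + rewrite ipow_S. right. assert (H := INR_S_ge_1 n). field. lra.
Qed.

Definition mzv (a b : nat) : R := Series (mzv_term a b).

Lemma is_lim_mzv (a b : nat) :
  (2 <= a)%nat -> (2 <= b \/ 3 <= a)%nat -> is_lim_seq (psum (mzv_term a b)) (mzv a b).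
Proof.
intros Ha Hb. apply is_series_psum, Series_correct. now apply ex_series_mzv.
Qed.

Lemma is_lim_zeta_nat (m : nat) :
  (2 <= m)%nat -> is_lim_seq (psum (ipow m)) (zeta_nat m).
Proof. intros H. now apply is_series_psum, is_series_zeta_nat. Qed.

Lemma ipow_add (a b n : nat) : ipow a n * ipow b n = ipow (a + b) n.
Proof. unfold ipow. now rewrite pow_add, Rinv_mult. Qed.

Lemma mzv_stuffle (a b : nat) : (2 <= a)%nat -> (2 <= b)%nat ->
  zeta_nat a * zeta_nat b = mzv a b + mzv b a + zeta_nat (a + b).
Proof.
intros Ha Hb.
assert (H1 : is_lim_seq (fun n => psum (ipow a) n * psum (ipow b) n) (zeta_nat a * zeta_nat b)).
{ apply is_lim_seq_mult'; now apply is_lim_zeta_nat. }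
assert (H2 : is_lim_seq (fun n => psum (mzv_term a b) n + psum (mzv_term b a) n + psum (ipow (a + b)) n)
   (mzv a b + mzv b a + zeta_nat (a + b))).
{ apply is_lim_seq_plus'. apply is_lim_seq_plus'; apply is_lim_mzv; lia.
  apply is_lim_zeta_nat; lia. }
apply is_lim_seq_ext with (v := fun n => psum (mzv_term a b) n + psum (mzv_term b a) n + psum (ipow (a + b)) n) in H1.
- apply is_lim_seq_unique in H1. apply is_lim_seq_unique in H2.
  rewrite H1 in H2. now injection H2.
- intros n. rewrite psum_mul.
  rewrite (psum_ext (fun n => ipow a n * ipow b n) (ipow (a + b))); auto.
  intros; apply ipow_add.
Qed.

(** The defect of the sum formula truncated at M: the sum over k <= M of
    k^(-p-1) (H_M - H_(M-k)), which comes from cutting off the telescoping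
    series of 1/(N-k) - 1/N. *)
Definition sum_formula_error (p M : nat) : R :=
  psum (fun k => ipow (S p) k * (harmonic M - harmonic (M - S k))) M.

Lemma sum_formula_error_step (p M : nat) :
  sum_formula_error p (S M) - sum_formula_error p M =
  ipow (S p) M * harmonic (S M) +
  psum (fun k => ipow (S p) k * (/ INR (S M) - / INR (M - k))) M.
Proof.
unfold sum_formula_error.
change (psum ?f (S M)) with (psum f M + f M). cbv beta.
rewrite Nat.sub_diag.
rewrite (psum_ext (fun k => ipow (S p) k * (harmonic (S M) - harmonic (S M - S k)))
  (fun k => ipow (S p) k * (harmonic M - harmonic (M - S k)) +
     ipow (S p) k * (/ INR (S M) - / INR (M - k)))).
- rewrite psum_plus. change (harmonic 0) with 0. ring.
- intros k Hk.
  replace (S M - S k)%nat with (S (M - S k)) by lia.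
  replace (M - k)%nat with (S (M - S k)) by lia.
  change (harmonic (S ?n)) with (harmonic n + / INR (S n)). ring.
Qed.

Lemma harmonic_diff_le (j n : nat) :
  harmonic (j + n) - harmonic j <= INR n / INR (S j).
Proof.
assert (H1 := INR_S_ge_1 j).
induction n.
- rewrite Nat.add_0_r. simpl INR. unfold Rdiv. rewrite Rmult_0_l. lra.
- rewrite Nat.add_succ_r. change (harmonic (S (j + n))) with (harmonic (j + n) + / INR (S (j + n))).
  rewrite (S_INR n). unfold Rdiv in *. rewrite Rmult_plus_distr_r, Rmult_1_l.
  assert (/ INR (S (j + n)) <= / INR (S j)).
  { apply Rinv_le_contravar; [lra|]. apply le_INR. lia. }
  lra.
Qed.

Lemma harmonic_mono (n k : nat) : harmonic n <= harmonic (n + k).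
Proof.
induction k. rewrite Nat.add_0_r; lra.
rewrite Nat.add_succ_r. change (harmonic (S (n + k))) with (harmonic (n + k) + / INR (S (n + k))).
assert (0 < / INR (S (n + k))) by (apply Rinv_0_lt_compat; assert (H3 := INR_S_ge_1 (n + k)); lra).
lra.
Qed.

(** H_M - H_(M-k) <= k/(M-k+1), and 1/(k (M+1-k)) is
    (1/k + 1/(M+1-k)) / (M+1). *)
Lemma sum_formula_error_bound (p M : nat) : (1 <= p)%nat ->
  0 <= sum_formula_error p M <= 2 * harmonic M / INR (S M).
Proof.
intros Hp. unfold sum_formula_error. split.
- rewrite <- (Rmult_0_l (psum (fun _ => 0) M)), <- psum_scal. apply psum_le. intros k Hk.
  assert (H := harmonic_mono (M - S k) (S k)). replace (M - S k + S k)%nat with M in H by lia.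
  assert (H' := ipow_pos (S p) k). nra.
- apply Rle_trans with (psum (fun k => / INR (S M) * (ipow 1 k + ipow 1 (M - S k))) M).
  + apply psum_le. intros k Hk.
    assert (H := harmonic_diff_le (M - S k) (S k)). replace (M - S k + S k)%nat with M in H by lia.
    assert (H' := ipow_pos (S p) k). assert (H'' := ipow_le (S p) 2 k ltac:(lia)).
    assert (Ha := INR_S_ge_1 k). assert (Hb := INR_S_ge_1 (M - S k)).
    assert (E : INR (S M) = INR (S k) + INR (S (M - S k))).
    { rewrite <- plus_INR. f_equal. lia. }
    apply Rle_trans with (ipow 2 k * (INR (S k) / INR (S (M - S k)))).
    * apply Rle_trans with (ipow (S p) k * (INR (S k) / INR (S (M - S k)))).
      -- apply Rmult_le_compat_l; lra.
      -- apply Rmult_le_compat_r; auto. apply Rlt_le, Rdiv_lt_0_compat; lra.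
    * right. unfold ipow. rewrite E. field. lra.
  + rewrite psum_scal, psum_plus, psum_rev, harmonic_psum. right. unfold Rdiv; ring.
Qed.

Lemma is_lim_sum_formula_error (p : nat) : (1 <= p)%nat ->
  is_lim_seq (sum_formula_error p) 0.
Proof.
intros Hp.
(* 2 H_M / (M+1) <= 4 sqrt M / (M+1) <= 4 / sqrt (M+1) *)
apply is_lim_seq_le_le with (fun _ => 0) (fun M => 4 * / sqrt (INR (S M))).
- intros M. destruct (sum_formula_error_bound p M Hp) as [H1 H2]. split; auto.
  eapply Rle_trans; [exact H2|].
  assert (H3 := harmonic_le M). assert (H4 := INR_S_ge_1 M).
  assert (H5 : sqrt (INR M) <= sqrt (INR (S M))).
  { apply sqrt_le_1. apply pos_INR. lra. apply le_INR; lia. }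
  assert (H6 := sqrt_sqrt (INR (S M)) ltac:(lra)).
  assert (H7 : 0 < sqrt (INR (S M))) by (apply sqrt_lt_R0; lra).
  set (y := sqrt (INR (S M))) in *. rewrite <- H6.
  apply Rle_trans with (2 * (2 * y) / (y * y)).
  + apply Rmult_le_compat_r. apply Rlt_le, Rinv_0_lt_compat; nra. lra.
  + right. field. lra.
- apply is_lim_seq_const.
- replace (Finite 0) with (Rbar_mult 4 0) by (simpl; f_equal; ring).
  apply is_lim_seq_scal_l.
  replace (Finite 0) with (Rbar_inv p_infty) by reflexivity.
  apply is_lim_seq_inv; [|discriminate].
  eapply filterlim_comp; [|exact filterlim_sqrt_p].
  apply (proj1 (is_lim_seq_incr_1 INR p_infty)), is_lim_seq_INR.
Qed.

Lemma psum_inv_rev (M : nat) : psum (fun k => / INR (M - k)) M = harmonic M.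
Proof.
rewrite harmonic_psum, <- psum_rev. apply psum_ext. intros k Hk.
unfold ipow. rewrite pow_1. do 2 f_equal. lia.
Qed.

(** With N = M + 1 and n = k + 1 the left side is a finite geometric sum in n/N;
    its denominator N - n is split off by 1/(n (N - n)) - 1/(n N) = 1/(N (N - n)). *)
Lemma geometric_partial_fractions (p M k : nat) : (k < M)%nat ->
  psum (fun j => ipow (S (S j)) M * ipow (p - j) k) p =
  ipow (S p) k * (/ INR (M - k) - / INR (S M)) - ipow (S p) M * / INR (M - k).
Proof.
intros Hk.
assert (Ha := INR_S_ge_1 k). assert (Hb := INR_S_ge_1 (M - S k)).
replace (S (M - S k)) with (M - k)%nat in Hb by lia.
assert (E : INR (S M) = INR (S k) + INR (M - k)).
{ rewrite <- plus_INR. f_equal. lia. }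
induction p.
- simpl psum. unfold ipow. rewrite !pow_1, E. field. lra.
- change (psum ?f (S p)) with (psum f p + f p). cbv beta.
  rewrite (psum_ext _ (fun j => / INR (S k) * (ipow (S (S j)) M * ipow (p - j) k))).
  + rewrite psum_scal, IHp, Nat.sub_succ_l, Nat.sub_diag, !(ipow_S (S p)) by lia.
    replace (ipow 1 k) with (/ INR (S k)) by (unfold ipow; now rewrite pow_1).
    rewrite E. field. lra.
  + intros j Hj. rewrite Nat.sub_succ_l, (ipow_S (p - j)) by lia. unfold Rdiv; ring.
Qed.

Lemma psum_swap (f : nat -> nat -> R) (p M : nat) :
  psum (fun j => psum (f j) M) p = psum (fun k => psum (fun j => f j k) p) M.
Proof.
induction M; simpl.
- induction p; simpl; auto. rewrite IHp. ring.
- now rewrite psum_plus, IHM.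
Qed.

Lemma mzv_sum_formula_finite (p M : nat) :
  psum (fun j => psum (mzv_term (S (S j)) (p - j)) M) p + sum_formula_error p M
  = psum (ipow (S (S p))) M.
Proof.
rewrite psum_swap. induction M.
- unfold sum_formula_error; simpl; ring.
- change (psum ?f (S M)) with (psum f M + f M). cbv beta. rewrite <- IHM.
  assert (HE := sum_formula_error_step p M).
  enough (psum (fun j => mzv_term (S (S j)) (p - j) M) p
    + ipow (S p) M * harmonic (S M)
    + psum (fun k => ipow (S p) k * (/ INR (S M) - / INR (M - k))) M = ipow (S (S p)) M) by lra.
  clear HE IHM. unfold mzv_term.
  rewrite (psum_ext _ (fun j => psum (fun k => ipow (S (S j)) M * ipow (p - j) k) M))
    by (intros; symmetry; apply psum_scal).
  rewrite psum_swap.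
  change (harmonic (S M)) with (harmonic M + / INR (S M)).
  rewrite <- psum_inv_rev, Rmult_plus_distr_l, <- psum_scal.
  rewrite (psum_ext (fun k => psum (fun j => ipow (S (S j)) M * ipow (p - j) k) p)
    (fun k => (-1) * (ipow (S p) k * (/ INR (S M) - / INR (M - k)))
       + (-1) * (ipow (S p) M * / INR (M - k)))).
  + rewrite psum_plus, !psum_scal, (ipow_S (S p)). unfold Rdiv; ring.
  + intros k Hk. rewrite geometric_partial_fractions by exact Hk. ring.
Qed.

Lemma is_lim_psum (u : nat -> nat -> R) (l : nat -> R) (p : nat) :
  (forall j, (j < p)%nat -> is_lim_seq (u j) (l j)) ->
  is_lim_seq (fun n => psum (fun j => u j n) p) (psum l p).
Proof.
induction p; intros H; simpl.
- apply is_lim_seq_const.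
- apply is_lim_seq_plus'; auto.
Qed.

(** Euler's sum formula in depth two: the double zeta values of weight p + 2
    with first argument at least 2 add up to zeta(p + 2). *)
Lemma mzv_sum_formula (p : nat) : (2 <= p)%nat ->
  psum (fun j => mzv (S (S j)) (p - j)) p = zeta_nat (S (S p)).
Proof.
intros Hp.
assert (H1 : is_lim_seq (fun M => psum (fun j => psum (mzv_term (S (S j)) (p - j)) M) p
    + sum_formula_error p M) (psum (fun j => mzv (S (S j)) (p - j)) p + 0)).
{ apply is_lim_seq_plus'.
  - apply (is_lim_psum (fun j => psum (mzv_term (S (S j)) (p - j)))).
    intros j Hj. apply is_lim_mzv; lia.
  - apply is_lim_sum_formula_error; lia. }
apply is_lim_seq_ext with (v := psum (ipow (S (S p)))) in H1.
- assert (H2 := is_lim_zeta_nat (S (S p)) ltac:(lia)).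
  apply is_lim_seq_unique in H1. apply is_lim_seq_unique in H2.
  rewrite H1 in H2. injection H2. lra.
- intros M. apply mzv_sum_formula_finite.
Qed.

Lemma sum_f_R0_psum (f : nat -> R) (n : nat) : sum_f_R0 f n = psum f (S n).
Proof. rewrite psum_S. symmetry. apply sum_n_Reals. Qed.

(** In the Cauchy product of the series of zeta(2) with itself, the terms
    1/(n^2 k^2) with n + k = N are decomposed by
    1/(n k) = (1/n + 1/k) / N. *)
Lemma zeta_2_sq_shuffle :
  zeta_nat 2 * zeta_nat 2 = 2 * mzv 2 2 + 4 * mzv 3 1.
Proof.
assert (H2 := is_series_zeta_nat 2 (le_n _)).
assert (Hp : forall n, 0 <= ipow 2 n) by (intros n; assert (H := ipow_pos 2 n); lra).
assert (HC := is_series_mult_pos _ _ _ _ H2 H2 Hp Hp).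
assert (E : forall n, sum_f_R0 (fun k => ipow 2 k * ipow 2 (n - k)) n =
   2 * mzv_term 2 2 (S n) + 4 * mzv_term 3 1 (S n)).
{ intros n. rewrite sum_f_R0_psum. unfold mzv_term.
  set (y := / INR (S (S n))).
  rewrite (psum_ext _ (fun k => y ^ 2 * (ipow 2 k + ipow 2 (S n - S k))
     + 2 * y ^ 3 * (ipow 1 k + ipow 1 (S n - S k)))).
  - rewrite psum_plus, !psum_scal, !psum_plus, !psum_rev.
    replace (ipow 2 (S n)) with (y ^ 2) by (unfold y; apply pow_inv).
    replace (ipow 3 (S n)) with (y ^ 3) by (unfold y; apply pow_inv). ring.
  - intros k Hk. simpl Nat.sub.
    assert (Ha := INR_S_ge_1 k). assert (Hb := INR_S_ge_1 (n - k)).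
    assert (E : INR (S (S n)) = INR (S k) + INR (S (n - k))).
    { rewrite <- plus_INR. f_equal. lia. }
    unfold ipow, y. rewrite E. field. lra. }
assert (HS : forall a b, (2 <= a)%nat -> (2 <= b \/ 3 <= a)%nat ->
   is_series (fun n => mzv_term a b (S n)) (mzv a b)).
{ intros a b Ha Hb. apply is_series_psum.
  apply is_lim_seq_ext with (fun n => psum (mzv_term a b) (S n)).
  - intros n. rewrite psum_head. unfold mzv_term at 1. simpl psum at 1. ring.
  - apply (is_lim_seq_incr_1 (psum (mzv_term a b))). now apply is_lim_mzv. }
assert (HR : is_series (fun n => 2 * mzv_term 2 2 (S n) + 4 * mzv_term 3 1 (S n))
   (2 * mzv 2 2 + 4 * mzv 3 1)).
{ apply (is_series_plus (K := R_AbsRing) (V := R_NormedModule)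
   (fun n => 2 * mzv_term 2 2 (S n)) (fun n => 4 * mzv_term 3 1 (S n))).
  - apply (is_series_scal (K := R_AbsRing) 2 (fun n => mzv_term 2 2 (S n))).
    apply HS; lia.
  - apply (is_series_scal (K := R_AbsRing) 4 (fun n => mzv_term 3 1 (S n))).
    apply HS; lia. }
apply is_series_unique in HC. apply is_series_unique in HR.
rewrite <- HC, <- HR. now apply Series_ext.
Qed.

Lemma mzv_3_1 : mzv 3 1 = zeta_nat 4 / 4.
Proof.
assert (H1 := mzv_sum_formula 2 (le_n _)). simpl in H1.
assert (H2 := mzv_stuffle 2 2 (le_n _) (le_n _)). simpl in H2.
assert (H3 := zeta_2_sq_shuffle). lra.
Qed.

Lemma mzv_4_1 : mzv 4 1 = 2 * zeta_nat 5 - zeta_nat 2 * zeta_nat 3.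
Proof.
assert (H1 := mzv_sum_formula 3 ltac:(lia)). simpl in H1.
assert (H2 := mzv_stuffle 2 3 (le_n _) ltac:(lia)). simpl in H2. lra.
Qed.

(** * Analytic continuation of the polylogarithm *)

(** The analogue of [real_eq] for complex numbers. *)
Ltac complex_eq := match goal with |- @eq _ ?a ?b => change (@eq C a b) end.

(** The projection of the line onto [0, 1].  Composing kernels with it makes
    them continuous on the whole line without changing them on [0, 1], the only
    part that the iterated average at 1 sees. *)
Definition clamp (t : R) : R := (Rabs t - Rabs (t - 1) + 1) / 2.

Lemma clamp_range (t : R) : 0 <= clamp t <= 1.
Proof.
unfold clamp. unfold Rabs. destruct (Rcase_abs t), (Rcase_abs (t - 1)); lra.
Qed.

Lemma clamp_id (t : R) : 0 <= t <= 1 -> clamp t = t.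
Proof.
intros Ht. unfold clamp. rewrite Rabs_pos_eq, Rabs_left1; lra.
Qed.

Lemma continuous_clamp (t : R) : continuous clamp t.
Proof.
unfold clamp.
apply (continuous_mult (fun t => Rabs t - Rabs (t - 1) + 1) (fun _ => / 2));
  [|apply continuous_const].
apply (continuous_plus (fun t => Rabs t - Rabs (t - 1)) (fun _ => 1));
  [|apply continuous_const].
apply (continuous_minus Rabs (fun t => Rabs (t - 1))).
- apply continuous_Rabs.
- apply (continuous_comp (fun t => t - 1) Rabs).
  apply (continuous_minus (fun t => t) (fun _ => 1)).
  apply continuous_id. apply continuous_const. apply continuous_Rabs.
Qed.

(** Continuity is stated for the two parts separately because integration is
    done on each of them. *)
Definition continuous_C (f : R -> C) : Prop :=
  (forall t, continuous (fun t => Re (f t)) t) /\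
  (forall t, continuous (fun t => Im (f t)) t).

Lemma continuous_C_ext (f g : R -> C) :
  (forall t, f t = g t) -> continuous_C f -> continuous_C g.
Proof.
intros H [H1 H2]; split; intros t.
- apply continuous_ext with (fun t => Re (f t)); auto. intros; now rewrite H.
- apply continuous_ext with (fun t => Im (f t)); auto. intros; now rewrite H.
Qed.

Lemma continuous_C_const (c : C) : continuous_C (fun _ => c).
Proof. split; intros t; apply continuous_const. Qed.

Lemma continuous_C_real (f : R -> R) :
  (forall t, continuous f t) -> continuous_C (fun t => RtoC (f t)).
Proof. intros H; split; intros t; simpl; [apply H|apply continuous_const]. Qed.

Lemma continuous_C_plus (f g : R -> C) :
  continuous_C f -> continuous_C g -> continuous_C (fun t => f t + g t)%C.
Proof.
intros [Hf1 Hf2] [Hg1 Hg2]; split; intros t.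
- apply (continuous_plus (fun t => Re (f t)) (fun t => Re (g t))); auto.
- apply (continuous_plus (fun t => Im (f t)) (fun t => Im (g t))); auto.
Qed.

Lemma continuous_C_mult (f g : R -> C) :
  continuous_C f -> continuous_C g -> continuous_C (fun t => f t * g t)%C.
Proof.
intros [Hf1 Hf2] [Hg1 Hg2]; split; intros t.
- apply (continuous_minus (fun t => Re (f t) * Re (g t)) (fun t => Im (f t) * Im (g t))).
  + apply (continuous_mult (fun t => Re (f t)) (fun t => Re (g t))); auto.
  + apply (continuous_mult (fun t => Im (f t)) (fun t => Im (g t))); auto.
- apply (continuous_plus (fun t => Re (f t) * Im (g t)) (fun t => Im (f t) * Re (g t))).
  + apply (continuous_mult (fun t => Re (f t)) (fun t => Im (g t))); auto.
  + apply (continuous_mult (fun t => Im (f t)) (fun t => Re (g t))); auto.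
Qed.

Lemma continuous_C_pow (f : R -> C) (n : nat) :
  continuous_C f -> continuous_C (fun t => Cpow (f t) n).
Proof.
intros H. induction n; simpl; [apply continuous_C_const|].
now apply continuous_C_mult.
Qed.

Lemma sq_norm_neq_0 (z : C) : z <> 0 -> Re z * Re z + Im z * Im z <> 0.
Proof.
intros Hz H. apply Hz. destruct z as [x y]. simpl in H.
apply injective_projections; simpl; nra.
Qed.

Lemma continuous_Rinv_comp (f : R -> R) (t : R) :
  continuous f t -> f t <> 0 -> continuous (fun t => / f t) t.
Proof.
intros H H0. apply (continuous_comp f Rinv); auto.
apply continuity_pt_filterlim, (continuity_pt_inv (fun x => x)); auto.
apply derivable_continuous_pt, derivable_pt_id.
Qed.

Lemma continuous_C_inv (f : R -> C) :
  (forall t, f t <> 0) -> continuous_C f -> continuous_C (fun t => / f t)%C.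
Proof.
intros H0 [H1 H2].
set (N := fun t => Re (f t) * Re (f t) + Im (f t) * Im (f t)).
assert (HN : forall t, continuous (fun t => / N t) t).
{ intros t. apply continuous_Rinv_comp; [|apply sq_norm_neq_0, H0].
  apply (continuous_plus (fun t => Re (f t) * Re (f t)) (fun t => Im (f t) * Im (f t))).
  - apply (continuous_mult (fun t => Re (f t)) (fun t => Re (f t))); auto.
  - apply (continuous_mult (fun t => Im (f t)) (fun t => Im (f t))); auto. }
apply continuous_C_ext with (fun t => (Re (f t) * / N t, - Im (f t) * / N t)).
- intros t. unfold Cinv, N, Rdiv. simpl. now rewrite !Rmult_1_r.
- split; intros t; simpl.
  + apply (continuous_mult (fun t => Re (f t)) (fun t => / N t)); auto.
  + apply (continuous_mult (fun t => - Im (f t)) (fun t => / N t)); auto.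
    apply (continuous_opp (fun t => Im (f t))); auto.
Qed.

(** The complex-linear extension of f |-> avg_iter m f 1. *)
Definition moment (m : nat) (f : R -> C) : C :=
  (avg_iter m (fun t => Re (f t)) 1, avg_iter m (fun t => Im (f t)) 1).

Lemma moment_ext (m : nat) (f g : R -> C) :
  (forall t, 0 <= t <= 1 -> f t = g t) -> moment m f = moment m g.
Proof.
intros H. unfold moment. f_equal; apply avg_iter_ext; try lra;
intros t Ht; now rewrite H.
Qed.

Lemma continuous_below_of_all (b : R) (f : R -> R) :
  (forall t, continuous f t) -> continuous_below b f.
Proof. intros H t _. apply H. Qed.

Lemma moment_plus (m : nat) (f g : R -> C) :
  continuous_C f -> continuous_C g ->
  moment m (fun t => f t + g t)%C = (moment m f + moment m g)%C.
Proof.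
intros [Hf1 Hf2] [Hg1 Hg2]. unfold moment.
apply injective_projections; simpl;
apply (avg_iter_plus 2); try lra; now apply continuous_below_of_all.
Qed.

Lemma moment_scal (m : nat) (c : C) (f : R -> C) :
  continuous_C f -> moment m (fun t => c * f t)%C = (c * moment m f)%C.
Proof.
intros [Hf1 Hf2].
assert (Hs : forall (x : R) (g : R -> R), (forall t, continuous g t) ->
   forall t, continuous (fun t => x * g t) t).
{ intros x g Hg t. apply (continuous_mult (fun _ => x) g); auto. apply continuous_const. }
assert (E : forall (x y : R) (g h : R -> R), (forall t, continuous g t) -> (forall t, continuous h t) ->
   avg_iter m (fun t => x * g t + y * h t) 1 = x * avg_iter m g 1 + y * avg_iter m h 1).
{ intros x y g h Hg Hh.
  rewrite (avg_iter_plus 2 m (fun t => x * g t) (fun t => y * h t)); try lra;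
    try (apply continuous_below_of_all; auto).
  f_equal; apply (avg_iter_scal 2); try lra; apply continuous_below_of_all; auto. }
unfold moment. apply injective_projections; simpl.
- rewrite <- (avg_iter_ext m (fun t => Re c * Re (f t) + - Im c * Im (f t))); try lra.
  + rewrite E by auto. unfold Re, Im. ring.
  + intros t _. unfold Re, Im; simpl. ring.
- rewrite <- (avg_iter_ext m (fun t => Re c * Im (f t) + Im c * Re (f t))); try lra.
  + rewrite E by auto. reflexivity.
  + intros t _. unfold Re, Im; simpl. ring.
Qed.

Lemma Cmod_le_sum (z : C) : Cmod z <= Rabs (Re z) + Rabs (Im z).
Proof.
destruct z as [x y]. simpl.
replace (x, y) with (RtoC x + Ci * RtoC y)%C
  by (apply injective_projections; simpl; ring).
eapply Rle_trans; [apply Cmod_triangle|].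
rewrite Cmod_mult, !Cmod_R.
replace (Cmod Ci) with 1; [lra|].
unfold Cmod, Ci; simpl. rewrite <- sqrt_1 at 1. f_equal. ring.
Qed.

Lemma im_le_Cmod (z : C) : Rabs (Im z) <= Cmod z.
Proof. eapply Rle_trans; [apply Rmax_r|apply Rmax_Cmod]. Qed.

Lemma moment_bound (m : nat) (f : R -> C) (M : R) :
  continuous_C f -> (forall t, 0 <= t <= 1 -> Cmod (f t) <= M) ->
  Cmod (moment m f) <= 2 * M.
Proof.
intros [Hf1 Hf2] HM. eapply Rle_trans; [apply Cmod_le_sum|].
assert (H1 : Rabs (avg_iter m (fun t => Re (f t)) 1) <= M).
{ apply (avg_iter_bound 2); try lra. now apply continuous_below_of_all.
  intros t Ht. eapply Rle_trans; [apply re_le_Cmod|auto]. }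
assert (H2 : Rabs (avg_iter m (fun t => Im (f t)) 1) <= M).
{ apply (avg_iter_bound 2); try lra. now apply continuous_below_of_all.
  intros t Ht. eapply Rle_trans; [apply im_le_Cmod|auto]. }
simpl. lra.
Qed.

(** For 0 <= t <= 1 this is 1/(1 - y t). *)
Definition resolvent (y : C) (t : R) : C := (/ (1 - y * RtoC (clamp t)))%C.

(** The candidate for the analytic continuation. *)
Definition complex_polylog (m : nat) (y : C) : C :=
  moment m (fun t => y * resolvent y t)%C.

(** The Taylor coefficients at x of y |-> y / (1 - y t). *)
Definition taylor_kernel (x : C) (n : nat) (t : R) : C :=
  match n with
  | O => x * resolvent x t
  | S k => Cpow (RtoC (clamp t)) k * Cpow (resolvent x t) (S (S k))
  end%C.

(** The exact remainder after the term of order n of the Taylor expansion of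
    y / (1 - y t) at x. *)
Definition taylor_remainder (x y : C) (n : nat) (t : R) : C :=
  (Cpow (y - x) (S n) * (Cpow (RtoC (clamp t)) n * Cpow (resolvent x t) (S n)
   * resolvent y t))%C.

(** 1 stays at distance at least d from the segment [0, x]; this d is a radius
    on which the Taylor expansion at x is valid. *)
Definition off_ray (d : R) (x : C) : Prop :=
  forall c, 0 <= c <= 1 -> d <= Cmod (1 - x * RtoC c).

Lemma off_ray_neq_0 (d : R) (x : C) (t : R) :
  0 < d -> off_ray d x -> (1 - x * RtoC (clamp t))%C <> 0.
Proof.
intros Hd H E. specialize (H (clamp t) (clamp_range t)). rewrite E, Cmod_0 in H. lra.
Qed.

Lemma continuous_C_resolvent (d : R) (x : C) :
  0 < d -> off_ray d x -> continuous_C (resolvent x).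
Proof.
intros Hd H. apply continuous_C_inv.
- intros t. now apply off_ray_neq_0 with d.
- apply (continuous_C_plus (fun _ => RtoC 1) (fun t => - (x * RtoC (clamp t)))%C).
  apply continuous_C_const.
  apply continuous_C_ext with (fun t => (- x) * RtoC (clamp t))%C.
  intros; ring. apply continuous_C_mult. apply continuous_C_const.
  apply continuous_C_real, continuous_clamp.
Qed.

Lemma Cmod_resolvent_le (d : R) (x : C) (t : R) :
  0 < d -> off_ray d x -> Cmod (resolvent x t) <= / d.
Proof.
intros Hd H. unfold resolvent. rewrite Cmod_inv by now apply off_ray_neq_0 with d.
apply Rinv_le_contravar; auto. apply H, clamp_range.
Qed.

(** Moving x by h moves x c by at most |h| when 0 <= c <= 1. *)
Lemma off_ray_near (d : R) (x y : C) :
  Cmod (y - x) < d -> off_ray d x -> off_ray (d - Cmod (y - x)) y.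
Proof.
intros Hy H c Hc. specialize (H c Hc).
replace (1 - x * RtoC c)%C with ((1 - y * RtoC c) + (y - x) * RtoC c)%C in H by ring.
assert (H1 := Cmod_triangle (1 - y * RtoC c) ((y - x) * RtoC c)).
rewrite Cmod_mult, Cmod_R, (Rabs_pos_eq c) in H1 by lra.
assert (H2 := Cmod_ge_0 (y - x)). nra.
Qed.

(** One step of the geometric series, from
    1/(1 - y t) = 1/(1 - x t) + (y - x) t / ((1 - x t) (1 - y t)). *)
Lemma taylor_expansion (d : R) (x y : C) (n : nat) (t : R) :
  0 < d -> off_ray d x -> Cmod (y - x) < d ->
  taylor_remainder x y n t =
  (Cpow (y - x) (S n) * taylor_kernel x (S n) t + taylor_remainder x y (S n) t)%C.
Proof.
intros Hd Hx Hy. assert (Hy' := off_ray_near d x y Hy Hx).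
unfold taylor_remainder, taylor_kernel, resolvent.
assert (H1 := off_ray_neq_0 _ _ t Hd Hx).
assert (Hd' : 0 < d - Cmod (y - x)) by lra.
assert (H2 := off_ray_neq_0 _ _ t Hd' Hy').
set (c := RtoC (clamp t)) in *. rewrite !Cpow_S. field. auto.
Qed.

Lemma taylor_expansion_0 (d : R) (x y : C) (t : R) :
  0 < d -> off_ray d x -> Cmod (y - x) < d ->
  (y * resolvent y t)%C = (taylor_kernel x 0 t + taylor_remainder x y 0 t)%C.
Proof.
intros Hd Hx Hy. assert (Hy' := off_ray_near d x y Hy Hx).
unfold taylor_remainder, taylor_kernel, resolvent.
assert (H1 := off_ray_neq_0 _ _ t Hd Hx).
assert (Hd' : 0 < d - Cmod (y - x)) by lra.
assert (H2 := off_ray_neq_0 _ _ t Hd' Hy').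
set (c := RtoC (clamp t)) in *. rewrite !Cpow_S. simpl. field. auto.
Qed.

Definition is_series_C (a : nat -> C) (l : C) : Prop :=
  is_series (K := C_AbsRing) (V := C_NormedModule) a l.

Lemma continuous_C_taylor_kernel (d : R) (x : C) (n : nat) :
  0 < d -> off_ray d x -> continuous_C (taylor_kernel x n).
Proof.
intros Hd H. assert (Hr := continuous_C_resolvent d x Hd H).
destruct n as [|n].
- apply (continuous_C_mult (fun _ => x)); auto. apply continuous_C_const.
- apply (continuous_C_mult (fun t => Cpow (RtoC (clamp t)) n)
    (fun t => Cpow (resolvent x t) (S (S n)))).
  + apply continuous_C_pow, continuous_C_real, continuous_clamp.
  + now apply continuous_C_pow.
Qed.

Lemma continuous_C_taylor_remainder (d : R) (x y : C) (n : nat) :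
  0 < d -> off_ray d x -> Cmod (y - x) < d -> continuous_C (taylor_remainder x y n).
Proof.
intros Hd Hx Hy. assert (Hy' := off_ray_near d x y Hy Hx).
assert (Hrx := continuous_C_resolvent d x Hd Hx).
assert (Hd' : 0 < d - Cmod (y - x)) by lra.
assert (Hry := continuous_C_resolvent _ y Hd' Hy').
apply (continuous_C_mult (fun _ => Cpow (y - x) (S n))). apply continuous_C_const.
apply (continuous_C_mult (fun t => (Cpow (RtoC (clamp t)) n * Cpow (resolvent x t) (S n))%C)); auto.
apply (continuous_C_mult (fun t => Cpow (RtoC (clamp t)) n)
    (fun t => Cpow (resolvent x t) (S n))).
- apply continuous_C_pow, continuous_C_real, continuous_clamp.
- now apply continuous_C_pow.
Qed.

Lemma complex_polylog_expansion (m : nat) (d : R) (x y : C) (n : nat) :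
  0 < d -> off_ray d x -> Cmod (y - x) < d ->
  complex_polylog m y =
  (sum_n (G := C_AbelianMonoid) (fun k => Cpow (y - x) k * moment m (taylor_kernel x k))%C n
   + moment m (taylor_remainder x y n))%C.
Proof.
intros Hd Hx Hy. induction n.
- rewrite sum_O. unfold complex_polylog.
  rewrite (moment_ext m _ (fun t => taylor_kernel x 0 t + taylor_remainder x y 0 t)%C).
  + rewrite moment_plus. simpl Cpow. ring.
    now apply continuous_C_taylor_kernel with d.
    now apply continuous_C_taylor_remainder with d.
  + intros t _. now apply taylor_expansion_0 with d.
- rewrite IHn, sum_Sn.
  rewrite (moment_ext m (taylor_remainder x y n)
    (fun t => Cpow (y - x) (S n) * taylor_kernel x (S n) t + taylor_remainder x y (S n) t)%C).
  + rewrite moment_plus, moment_scal.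
    * change (plus ?a ?b) with (Cplus a b). ring.
    * now apply continuous_C_taylor_kernel with d.
    * apply (continuous_C_mult (fun _ => Cpow (y - x) (S n))). apply continuous_C_const.
      now apply continuous_C_taylor_kernel with d.
    * now apply continuous_C_taylor_remainder with d.
  + intros t _. now apply taylor_expansion with d.
Qed.

Lemma Cmod_taylor_remainder_le (d : R) (x y : C) (n : nat) (t : R) :
  0 < d -> off_ray d x -> Cmod (y - x) < d ->
  Cmod (taylor_remainder x y n t) <= (Cmod (y - x) / d) ^ S n * / (d - Cmod (y - x)).
Proof.
intros Hd Hx Hy. assert (Hy' := off_ray_near d x y Hy Hx).
assert (Hd' : 0 < d - Cmod (y - x)) by lra.
unfold taylor_remainder. rewrite !Cmod_mult, !Cmod_pow, Cmod_R.
assert (Hc := clamp_range t). rewrite (Rabs_pos_eq (clamp t)) by lra.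
assert (H1 := Cmod_resolvent_le d x t Hd Hx).
assert (H2 := Cmod_resolvent_le _ y t Hd' Hy').
unfold Rdiv. rewrite Rpow_mult_distr, (Rmult_assoc (_ ^ S n) ((/ d) ^ S n)).
assert (Hh := Cmod_ge_0 (y - x)).
apply Rmult_le_compat_l; [now apply pow_le|].
assert (Hp : 0 <= clamp t ^ n <= 1).
{ split. apply pow_le; lra. rewrite <- (pow1 n). apply pow_incr; lra. }
assert (Hq : 0 <= Cmod (resolvent x t) ^ S n <= (/ d) ^ S n).
{ split. apply pow_le, Cmod_ge_0. apply pow_incr. split; auto. apply Cmod_ge_0. }
apply Rmult_le_compat; auto.
- apply Rmult_le_pos; lra.
- apply Cmod_ge_0.
- nra.
Qed.

Lemma is_series_C_of_remainder (a : nat -> C) (l : C) (e : nat -> R) :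
  (forall n, Cmod (l - sum_n (G := C_AbelianMonoid) a n) <= e n) ->
  is_lim_seq e 0 -> is_series_C a l.
Proof.
intros H He. apply filterlim_locally_ball_norm. intros eps.
apply is_lim_seq_spec in He. destruct (He eps) as [N HN].
exists N. intros n Hn. specialize (HN n Hn). specialize (H n).
change (Cmod (sum_n (G := C_AbelianMonoid) a n - l) < eps).
replace (sum_n (G := C_AbelianMonoid) a n - l)%C with (- (l - sum_n (G := C_AbelianMonoid) a n))%C by ring.
rewrite Cmod_opp. rewrite Rminus_0_r in HN. apply Rabs_def2 in HN. lra.
Qed.

(** The exact expansion of the kernel passes through the linear functional term
    by term, and its remainder is bounded uniformly in t by a geometric
    sequence, so no interchange of limits is involved. *)
Lemma is_series_complex_polylog (m : nat) (d : R) (x y : C) :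
  0 < d -> off_ray d x -> Cmod (y - x) < d ->
  is_series_C (fun k => Cpow (y - x) k * moment m (taylor_kernel x k))%C
    (complex_polylog m y).
Proof.
intros Hd Hx Hy.
apply is_series_C_of_remainder with
  (fun n => 2 * / (d - Cmod (y - x)) * (Cmod (y - x) / d) ^ S n).
- intros n. rewrite (complex_polylog_expansion m d x y n) at 1 by auto.
  match goal with |- Cmod (?a + ?b - ?a) <= _ => replace (a + b - a)%C with b by ring end.
  eapply Rle_trans;
    [apply (moment_bound m _ ((Cmod (y - x) / d) ^ S n * / (d - Cmod (y - x))))|].
  + now apply continuous_C_taylor_remainder with d.
  + intros t _. now apply Cmod_taylor_remainder_le.
  + right. ring.
- assert (H := Cmod_ge_0 (y - x)).
  assert (Hq : Rabs (Cmod (y - x) / d) < 1).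
  { rewrite Rabs_pos_eq.
    - apply Rmult_lt_reg_r with d; auto. unfold Rdiv. rewrite Rmult_assoc, Rinv_l; lra.
    - apply Rmult_le_pos; auto. apply Rlt_le, Rinv_0_lt_compat, Hd. }
  replace (Finite 0) with (Rbar_mult (2 * / (d - Cmod (y - x))) 0)
    by (simpl; f_equal; ring).
  apply is_lim_seq_scal_l, (proj1 (is_lim_seq_incr_1 (fun n => (Cmod (y - x) / d) ^ n) 0)).
  now apply is_lim_seq_geom.
Qed.

(** If x is real this is clear.  Otherwise, for small c the real part of
    1 - x c is at least 1/2, and for larger c the imaginary part is bounded
    away from 0. *)
Lemma slit_plane_off_ray (x : C) : slit_plane x -> exists d, 0 < d /\ off_ray d x.
Proof.
destruct x as [a b]. intros Hs. unfold slit_plane in Hs; simpl in Hs.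
assert (Hre : forall c, Rabs (1 - a * c) <= Cmod (1 - (a, b) * RtoC c)).
{ intros c. eapply Rle_trans; [|apply re_le_Cmod]. right. simpl. f_equal. ring. }
assert (Him : forall c, Rabs (b * c) <= Cmod (1 - (a, b) * RtoC c)).
{ intros c. eapply Rle_trans; [|apply im_le_Cmod]. right. simpl.
  rewrite <- Rabs_Ropp. f_equal. ring. }
destruct (Req_dec b 0) as [Hb|Hb].
- assert (Ha : a < 1) by (destruct (Rlt_dec a 1); auto; exfalso; apply Hs; split; lra).
  (* 1 - a c is at least 1 when a <= 0, and at least 1 - a otherwise. *)
  exists (Rmin 1 (1 - a)). split. apply Rmin_pos; lra.
  intros c Hc. eapply Rle_trans; [|apply Hre].
  destruct (Rle_dec a 0).
  + rewrite Rabs_pos_eq by nra. eapply Rle_trans; [apply Rmin_l|nra].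
  + rewrite Rabs_pos_eq by nra. eapply Rle_trans; [apply Rmin_r|nra].
- assert (Hb' := Rabs_pos_lt _ Hb). assert (Ha' := Rabs_pos a).
  (* The threshold c0 is chosen so that |a| c0 <= 1/2. *)
set (c0 := / (2 * (Rabs a + 1))).
  assert (Hc0 : 0 < c0) by (apply Rinv_0_lt_compat; lra).
  assert (Ec : c0 * (2 * (Rabs a + 1)) = 1) by (apply Rinv_l; lra).
  exists (Rmin (1 / 2) (Rabs b * c0)). split. apply Rmin_pos; nra.
  intros c Hc. destruct (Rle_dec c c0) as [H|H].
  + eapply Rle_trans; [apply Rmin_l|]. eapply Rle_trans; [|apply Hre].
    eapply Rle_trans; [|apply Rle_abs].
    assert (a * c <= Rabs a * c0).
    { apply Rle_trans with (Rabs a * c).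
      apply Rmult_le_compat_r; [lra|apply Rle_abs]. apply Rmult_le_compat_l; lra. }
    nra.
  + eapply Rle_trans; [apply Rmin_r|]. eapply Rle_trans; [|apply Him].
    rewrite Rabs_mult, (Rabs_pos_eq c) by lra. apply Rmult_le_compat_l; lra.
Qed.

Lemma pow_n_Cpow (x : C) (n : nat) : pow_n (K := C_Ring) x n = Cpow x n.
Proof. induction n; [reflexivity|]. simpl. now rewrite IHn. Qed.

Lemma is_pseries_C (a : nat -> C) (x l : C) :
  is_pseries (K := C_AbsRing) (V := C_NormedModule) a x l <->
  is_series_C (fun n => Cpow x n * a n)%C l.
Proof.
assert (E : forall n, scal (V := C_NormedModule) (pow_n (K := C_AbsRing) x n) (a n)
  = (Cpow x n * a n)%C).
{ intros n. rewrite <- pow_n_Cpow. reflexivity. }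
split; apply is_series_ext; intros n; [exact (E n)|exact (eq_sym (E n))].
Qed.

Lemma moment_real (m : nat) (g : R -> R) :
  moment m (fun t => RtoC (g t)) = RtoC (avg_iter m g 1).
Proof.
unfold moment, RtoC. simpl. f_equal.
rewrite (avg_iter_ext m _ (fun t => 0 * t ^ 0)); [|intros; ring|lra].
rewrite (avg_iter_scal 2 m 0 (fun t => t ^ 0)); try lra.
intros t _. apply continuous_const.
Qed.

Lemma moment_pow (m n : nat) :
  moment m (fun t => Cpow (RtoC (clamp t)) n) = RtoC (/ INR (S n) ^ m).
Proof.
rewrite (moment_ext m _ (fun t => RtoC (t ^ n))).
- rewrite moment_real, avg_iter_pow, pow1. f_equal. apply Rmult_1_l.
- intros t Ht. now rewrite clamp_id, <- RtoC_pow by lra.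
Qed.

Lemma is_series_C_shift (a : nat -> C) (l : C) :
  is_series_C a l -> a O = 0 -> is_series_C (fun n => a (S n)) l.
Proof.
intros H H0. apply (is_series_incr_1 (K := C_AbsRing) (V := C_NormedModule) a l).
rewrite H0. change (is_series_C a (l + 0)%C). rewrite Cplus_0_r. exact H.
Qed.

(** The Taylor expansion at the origin is valid with d = 1, and its coefficients
    are the moments of t^n: it is the defining series, on the whole unit disk. *)
Lemma is_polylog_complex_polylog (m : nat) : is_polylog m (complex_polylog m).
Proof.
split.
- intros x Hx. destruct (slit_plane_off_ray x Hx) as [d [Hd Hod]].
  exists (fun n => moment m (taylor_kernel x n)), d. split; auto.
  intros y Hy. apply is_pseries_C. now apply is_series_complex_polylog with d.
- intros x Hx.
  assert (H0 : off_ray 1 0).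
  { intros c Hc. replace (1 - 0 * RtoC c)%C with (RtoC 1) by ring.
    rewrite Cmod_1. lra. }
  assert (H := is_series_complex_polylog m 1 0 x Rlt_0_1 H0).
  replace (x - 0)%C with x in H by ring. specialize (H Hx).
  assert (H1 : is_series_C
     (fun k => Cpow x (S k) * moment m (taylor_kernel 0 (S k)))%C
     (complex_polylog m x)).
  { apply (is_series_C_shift (fun k => Cpow x k * moment m (taylor_kernel 0 k))%C); auto.
    unfold taylor_kernel. rewrite moment_scal by (apply continuous_C_resolvent with 1; [lra|exact H0]).
    complex_eq. ring. }
  eapply is_series_ext; [|exact H1].
  intros k. complex_eq. cbv beta.
  rewrite (moment_ext m (taylor_kernel 0 (S k)) (fun t => Cpow (RtoC (clamp t)) k)).
  + rewrite moment_pow, RtoC_inv, RtoC_pow. reflexivity.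
    apply pow_nonzero, not_0_INR. lia.
  + intros t _. unfold taylor_kernel, resolvent.
    replace (1 - 0 * RtoC (clamp t))%C with (RtoC 1) by ring.
    replace (/ 1)%C with (RtoC 1) by field. rewrite Cpow_1_l. ring.
Qed.

(** For real x the kernel is real, and homogeneity of the average moves x from
    the kernel to the point of evaluation. *)
Lemma complex_polylog_real (m : nat) (x : R) :
  x < 1 -> complex_polylog m (RtoC x) = RtoC (polylog m x).
Proof.
intros Hx. unfold complex_polylog.
assert (Hne : forall t, 1 - x * clamp t <> 0).
{ intros t. assert (H := clamp_range t). destruct (Rle_dec x 0); nra. }
rewrite (moment_ext m _ (fun t => RtoC (x * geom (x * clamp t)))).
- rewrite moment_real. unfold polylog. f_equal.
  rewrite (avg_iter_scal 2 m x (fun t => geom (x * clamp t))); try lra.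
  + f_equal. rewrite (avg_iter_ext m _ (fun t => geom (x * t)));
      [|intros t Ht; now rewrite clamp_id|lra].
    rewrite avg_iter_scale. f_equal. ring.
  + intros t _. apply (continuous_Rinv_comp (fun t => 1 - x * clamp t)); auto.
    apply (continuous_minus (fun _ => 1) (fun t => x * clamp t)).
    apply continuous_const.
    apply (continuous_mult (fun _ => x) clamp). apply continuous_const.
    apply continuous_clamp.
- intros t _. unfold resolvent, geom.
  rewrite <- RtoC_mult, <- RtoC_minus, <- RtoC_inv, <- RtoC_mult by apply Hne.
  reflexivity.
Qed.

(** * Uniqueness along the real axis *)

(** Zero values on one side of the centre suffice: the constant coefficient
    vanishes by continuity, and dividing by h shifts the series. *)
Lemma power_series_right_zero (r : R) (n : nat) : forall b : nat -> R,
  0 < r -> (forall h, 0 < h < r -> is_series (fun k => b k * h ^ k) 0) -> b n = 0.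
Proof.
assert (H0 : forall b, 0 < r ->
  (forall h, 0 < h < r -> is_series (fun k => b k * h ^ k) 0) -> b O = 0).
{ intros b Hr H.
  assert (Hc : continuity_pt (PSeries b) 0).
  { apply PSeries_continuity. rewrite Rabs_R0.
    apply Rbar_lt_le_trans with (Finite (Rabs (r / 2))).
    - simpl. rewrite Rabs_pos_eq; lra.
    - apply CV_radius_ge. exists 0. apply H. lra. }
  destruct (Req_dec (b O) 0) as [|Hb]; auto. exfalso.
  destruct (Hc (Rabs (b O)) (Rabs_pos_lt _ Hb)) as [d [Hd Hcd]].
  set (h := Rmin (d / 2) (r / 2)).
  assert (Hh : 0 < h) by (apply Rmin_pos; lra).
  assert (Hh1 : h <= d / 2) by apply Rmin_l. assert (Hh2 : h <= r / 2) by apply Rmin_r.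
  assert (Hx := Hcd h). simpl in Hx. unfold Rdist in Hx.
  rewrite PSeries_0 in Hx.
  rewrite (is_pseries_unique b h 0) in Hx.
  - rewrite Rminus_0_l, Rabs_Ropp in Hx.
    apply (Rlt_irrefl (Rabs (b O))), Hx. split.
    + split; [exact I|lra].
    + rewrite Rminus_0_r, Rabs_pos_eq; lra.
  - apply (proj2 (is_pseries_R b h 0)), H. lra. }
induction n; intros b Hr H; auto.
apply (IHn (PS_decr_1 b)); auto. intros h Hh.
apply (proj1 (is_pseries_R (PS_decr_1 b) h 0)).
assert (Hs := proj2 (is_pseries_R b h 0) (H h Hh)).
apply (is_pseries_decr_1 b h (/ h)) in Hs; [|change (/ h * h = 1); field; lra].
match type of Hs with is_pseries _ _ ?v => replace v with 0 in Hs; auto end.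
change (0 = / h * (0 + - b O)). rewrite (H0 b Hr H). ring.
Qed.

Definition real_analytic_at (u : R -> R) (s : R) : Prop :=
  exists (b : nat -> R) (r : R), 0 < r /\
  forall y, Rabs (y - s) < r -> is_series (fun n => b n * (y - s) ^ n) (u y).

(** Zeros on one side of s annihilate all Taylor coefficients at s, which also
    determine u on the other side. *)
Lemma analytic_zero_left (u : R -> R) (s e : R) :
  0 < e -> real_analytic_at u s -> (forall y, s < y < s + e -> u y = 0) ->
  exists r, 0 < r /\ forall y, Rabs (y - s) < r -> u y = 0.
Proof.
intros He [b [r [Hr Hb]]] Hu. exists r. split; auto. intros y Hy.
assert (Hz : forall n, b n = 0).
{ intros n. apply (power_series_right_zero (Rmin r e)).
  - apply Rmin_pos; auto.
  - intros h Hh. assert (Rmin r e <= r) by apply Rmin_l.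
    assert (Rmin r e <= e) by apply Rmin_r.
    assert (H1 := Hb (s + h)). replace (s + h - s) with h in H1 by ring.
    rewrite Hu in H1 by lra. apply H1. rewrite Rabs_pos_eq; lra. }
specialize (Hb y Hy). apply is_series_unique in Hb. rewrite <- Hb.
rewrite (Series_ext _ (fun n => 0 * b n)).
- rewrite Series_scal_l. ring.
- intros n. rewrite Hz. ring.
Qed.

(** Otherwise the lengths t for which u vanishes on [-t, 0] would have a finite
    supremum, and analyticity there would let the interval grow beyond it. *)
Lemma analytic_zero_continuation (u : R -> R) :
  (forall s, s < 1 -> real_analytic_at u s) -> (forall x, Rabs x < 1 -> u x = 0) ->
  forall x, x < 1 -> u x = 0.
Proof.
intros Ha H0 x Hx.
destruct (Rle_dec 0 x) as [Hx0|Hx0]; [apply H0; rewrite Rabs_pos_eq; lra|].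
destruct (Req_dec (u x) 0) as [|Hne]; auto. exfalso.
(* x < 0 because the unit interval is covered by hypothesis; -x bounds the
   lengths in E since u does not vanish at x. *)
set (E := fun t => 0 <= t /\ forall y, - t <= y <= 0 -> u y = 0).
destruct (completeness E) as [t [Hub Hlub]].
- exists (- x). intros t [Ht H]. destruct (Rle_dec t (- x)); auto.
  exfalso. apply Hne, H. lra.
- exists 0. split; [lra|]. intros y Hy. apply H0. rewrite Rabs_left1; lra.
- assert (Ht0 : 1 / 2 <= t).
  { apply Hub. split; [lra|]. intros y Hy. apply H0. rewrite Rabs_left1; lra. }
  assert (Hin : forall y, - t < y <= 0 -> u y = 0).
  { intros y Hy. destruct (Req_dec (u y) 0) as [|Hy']; auto. exfalso.
    assert (t <= - y); [|lra]. apply Hlub. intros w [Hw H].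
    destruct (Rle_dec w (- y)); auto. exfalso. apply Hy', H. lra. }
  destruct (analytic_zero_left u (- t) t) as [r [Hr Hz]]; try lra.
  + apply Ha. lra.
  + intros y Hy. apply Hin. lra.
  + assert (E (t + r / 2)).
    { split; [lra|]. intros y Hy. destruct (Rlt_dec (- t) y).
      - apply Hin; lra.
      - apply Hz. rewrite Rabs_left1; lra. }
    specialize (Hub _ H). lra.
Qed.

Lemma is_series_C_parts (a : nat -> C) (l : C) : is_series_C a l ->
  is_series (fun n => Re (a n)) (Re l) /\ is_series (fun n => Im (a n)) (Im l).
Proof.
intros H. unfold is_series_C, is_series in H.
assert (H' := proj1 (filterlim_locally_ball_norm (K := C_AbsRing) (U := C_NormedModule)
  (F := eventually) (sum_n a) l) H).
assert (ES : forall n, Re (sum_n (G := C_AbelianMonoid) a n) = sum_n (fun k => Re (a k)) n /\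
   Im (sum_n (G := C_AbelianMonoid) a n) = sum_n (fun k => Im (a k)) n).
{ induction n.
  - now rewrite !sum_O.
  - rewrite !sum_Sn. destruct IHn as [<- <-]. split; reflexivity. }
assert (HH : forall g : C -> R, (forall z w, g (z - w)%C = g z - g w) ->
  (forall z, Rabs (g z) <= Cmod z) ->
  is_lim_seq (fun n => g (sum_n (G := C_AbelianMonoid) a n)) (g l)).
{ intros g Hg Hm. apply is_lim_seq_spec. intros eps.
  destruct (H' eps) as [N HN]. exists N. intros n Hn. rewrite <- Hg.
  eapply Rle_lt_trans; [apply Hm|]. exact (HN n Hn). }
split.
- apply (is_lim_seq_ext (fun n => Re (sum_n (G := C_AbelianMonoid) a n)) _ (Re l)).
  apply ES. apply HH. intros; reflexivity. apply re_le_Cmod.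
- apply (is_lim_seq_ext (fun n => Im (sum_n (G := C_AbelianMonoid) a n)) _ (Im l)).
  apply ES. apply HH. intros; reflexivity. apply im_le_Cmod.
Qed.

Lemma analytic_at_real_parts (f : C -> C) (s : R) : analytic_at f (RtoC s) ->
  real_analytic_at (fun y => Re (f (RtoC y))) s /\
  real_analytic_at (fun y => Im (f (RtoC y))) s.
Proof.
intros [a [r [Hr Ha]]].
assert (H : forall y, Rabs (y - s) < r ->
  is_series_C (fun n => RtoC ((y - s) ^ n) * a n)%C (f (RtoC y))).
{ intros y Hy. specialize (Ha (RtoC y)). rewrite <- RtoC_minus, Cmod_R in Ha.
  specialize (Ha Hy). apply is_pseries_C in Ha.
  eapply is_series_ext; [|exact Ha]. intros n. now rewrite RtoC_pow. }
split.
- exists (fun n => Re (a n)), r. split; auto. intros y Hy.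
  eapply is_series_ext; [|apply is_series_C_parts, H, Hy].
  intros n. cbv beta. rewrite re_scal_l. apply Rmult_comm.
- exists (fun n => Im (a n)), r. split; auto. intros y Hy.
  eapply is_series_ext; [|apply is_series_C_parts, H, Hy].
  intros n. cbv beta. rewrite im_scal_l. apply Rmult_comm.
Qed.

Lemma real_analytic_minus (u v : R -> R) (s : R) :
  real_analytic_at u s -> real_analytic_at v s ->
  real_analytic_at (fun y => u y - v y) s.
Proof.
intros [a [r [Hr Ha]]] [b [q [Hq Hb]]].
exists (fun n => a n - b n), (Rmin r q). split. apply Rmin_pos; auto.
intros y Hy.
assert (H1 := Ha y (Rlt_le_trans _ _ _ Hy (Rmin_l r q))).
assert (H2 := Hb y (Rlt_le_trans _ _ _ Hy (Rmin_r r q))).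
eapply is_series_ext; [|exact (is_series_minus _ _ _ _ H1 H2)].
intros n. change (a n * (y - s) ^ n - b n * (y - s) ^ n = (a n - b n) * (y - s) ^ n). ring.
Qed.

Lemma is_polylog_unique_real (m : nat) (f g : C -> C) (x : R) :
  is_polylog m f -> is_polylog m g -> x < 1 -> f (RtoC x) = g (RtoC x).
Proof.
intros [Hf1 Hf2] [Hg1 Hg2] Hx.
assert (Hs : forall s, s < 1 -> slit_plane (RtoC s)).
{ intros s Hs [_ H]. simpl in H. lra. }
assert (Heq : forall y, Rabs y < 1 -> f (RtoC y) = g (RtoC y)).
{ intros y Hy. rewrite <- Cmod_R in Hy.
  apply (filterlim_locally_unique (K := C_AbsRing) (V := C_NormedModule) (F := eventually)
    _ _ _ (Hf2 _ Hy) (Hg2 _ Hy)). }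
apply injective_projections.
- apply Rminus_diag_uniq.
  apply (analytic_zero_continuation (fun y => Re (f (RtoC y)) - Re (g (RtoC y)))); auto.
  + intros s Hs'. apply real_analytic_minus; apply analytic_at_real_parts; auto.
  + intros y Hy. rewrite Heq by auto. ring.
- apply Rminus_diag_uniq.
  apply (analytic_zero_continuation (fun y => Im (f (RtoC y)) - Im (g (RtoC y)))); auto.
  + intros s Hs'. apply real_analytic_minus; apply analytic_at_real_parts; auto.
  + intros y Hy. rewrite Heq by auto. ring.
Qed.

(** The values of Li on this half-line are forced, although Li is obtained by
    choice. *)
Lemma Li_real (m : nat) (x : R) : x < 1 -> Li m (RtoC x) = RtoC (polylog m x).
Proof.
intros Hx. rewrite <- complex_polylog_real by exact Hx.
apply (is_polylog_unique_real m); auto.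
- apply (epsilon_spec (inhabits (fun _ : C => RtoC 0)) (is_polylog m)).
  exists (complex_polylog m). apply is_polylog_complex_polylog.
- apply is_polylog_complex_polylog.
Qed.

(** * Differentiation in q and limits at 1 *)

Lemma is_derive_one_sub (q : R) : is_derive (fun t => 1 - t) q (- 1).
Proof. auto_derive; auto. Qed.

Lemma is_derive_one_sub_inv (q : R) (Hq : 0 < q < 1) : is_derive (fun t => 1 - / t) q (/ q ^ 2).
Proof. auto_derive. lra. field; lra. Qed.

Lemma one_sub_inv_neg (q : R) (Hq : 0 < q < 1) : 1 - / q < 0.
Proof.
assert (1 < / q); [|lra]. rewrite <- Rinv_1. apply Rinv_lt_contravar; lra.
Qed.

Lemma is_derive_ln_id (q : R) (Hq : 0 < q < 1) : is_derive (fun t => ln t) q (/ q).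
Proof. auto_derive. lra. field; lra. Qed.

Lemma is_derive_ln_one_sub (q : R) (Hq : 0 < q < 1) : is_derive (fun t => ln (1 - t)) q (- / (1 - q)).
Proof. auto_derive. lra. field; lra. Qed.

(** The property shared by polylogarithms and Nielsen polylogarithms from which
    all derivatives below are computed. *)
Definition tower (f : nat -> R -> R) : Prop :=
  forall k x, x < 1 -> x <> 0 -> is_derive (f (S k)) x (f k x / x).

Lemma is_derive_tower (q : R) (Hq : 0 < q < 1) (f : nat -> R -> R) (Hf : tower f) (k : nat) : is_derive (fun t => f (S k) t) q (f k q / q).
Proof. apply Hf; lra. Qed.

Lemma is_derive_tower_one_sub (q : R) (Hq : 0 < q < 1) (f : nat -> R -> R) (Hf : tower f) (k : nat) :
  is_derive (fun t => f (S k) (1 - t)) q (- (f k (1 - q) / (1 - q))).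
Proof.
eapply is_derive_value.
- apply (is_derive_Rcomp (f (S k)) (fun t => 1 - t)).
  apply Hf; lra. apply is_derive_one_sub.
- ring.
Qed.

Lemma is_derive_tower_one_sub_inv (q : R) (Hq : 0 < q < 1) (f : nat -> R -> R) (Hf : tower f) (k : nat) :
  is_derive (fun t => f (S k) (1 - / t)) q (- (f k (1 - / q) / (q * (1 - q)))).
Proof.
assert (H := one_sub_inv_neg q Hq).
eapply is_derive_value.
- apply (is_derive_Rcomp (f (S k)) (fun t => 1 - / t)).
  apply Hf; lra. apply (is_derive_one_sub_inv q Hq).
- field. repeat split; lra.
Qed.

Lemma polylog_1_one_sub (q : R) (Hq : 0 < q < 1) : polylog 1 (1 - q) = - ln q.
Proof. rewrite polylog_1 by lra. do 2 f_equal. ring. Qed.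

Lemma polylog_1_one_sub_inv (q : R) (Hq : 0 < q < 1) : polylog 1 (1 - / q) = ln q.
Proof.
assert (H := one_sub_inv_neg q Hq). rewrite polylog_1 by lra.
replace (1 - (1 - / q)) with (/ q) by ring. rewrite ln_Rinv by lra. ring.
Qed.

Lemma nielsen2_0_one_sub (q : R) (Hq : 0 < q < 1) : nielsen2 0 (1 - q) = ln q * ln q / 2.
Proof.
rewrite nielsen2_0 by lra. replace (1 - (1 - q)) with q by ring. field.
Qed.

Lemma nielsen2_0_one_sub_inv (q : R) (Hq : 0 < q < 1) : nielsen2 0 (1 - / q) = ln q * ln q / 2.
Proof.
assert (H := one_sub_inv_neg q Hq). rewrite nielsen2_0 by lra.
replace (1 - (1 - / q)) with (/ q) by ring. rewrite ln_Rinv by lra. field.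
Qed.

(** How every identity below is proved: a function with zero derivative on (0, 1)
    equals its limit at 1. *)
Lemma eq_of_derive_0 (F : R -> R) (c q : R) :
  (forall t, 0 < t < 1 -> is_derive F t 0) -> tends (at_left 1) F c ->
  0 < q < 1 -> F q = c.
Proof.
intros HF Hc Hq.
assert (Hconst : forall t, q < t < 1 -> F q = F t).
{ intros t Ht. destruct (MVT_gen F q t (fun _ => 0)) as [x [_ Hx]].
  - intros x Hx. rewrite Rmin_left, Rmax_right in Hx by lra. apply HF; lra.
  - intros x Hx. rewrite Rmin_left, Rmax_right in Hx by lra.
    apply continuity_pt_filterlim.
    apply (ex_derive_continuous F). eexists. apply HF; lra.
  - lra. }
apply (filterlim_locally_unique (K := R_AbsRing) (V := R_NormedModule) (F := at_left 1) F).
- apply (filterlim_ext_loc (fun _ => F q)).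
  + apply (at_left_of_interval q 1). lra. exact Hconst.
  + apply filterlim_const.
- exact Hc.
Qed.

Lemma tends_value (F : (R -> Prop) -> Prop) (f : R -> R) (a b : R) :
  tends F f a -> a = b -> tends F f b.
Proof. now intros H <-. Qed.

Lemma tends_minus (F : (R -> Prop) -> Prop) {FF : Filter F} (f g : R -> R) (a b : R) :
  tends F f a -> tends F g b -> tends F (fun x => f x - g x) (a - b).
Proof.
intros Hf Hg. apply (filterlim_ext (fun x => f x + -1 * g x)).
{ intros x. real_eq. ring. }
replace (a - b) with (a + -1 * b) by ring.
apply (tends_plus F); auto. apply (tends_mult F); auto. apply tends_const; auto.
Qed.

Lemma tends_ln_left_1 : tends (at_left 1) (fun t => ln t) 0.
Proof.
rewrite <- ln_1. apply (tends_left_of_continuous ln).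
apply (ex_derive_continuous ln). auto_derive. lra.
Qed.

Lemma tends_one_sub_left_1 (f : R -> R) :
  continuous f 0 -> tends (at_left 1) (fun t => f (1 - t)) (f 0).
Proof.
intros Hf. replace (f 0) with (f (1 - 1)) by (f_equal; ring).
apply (tends_left_of_continuous (fun t => f (1 - t))).
apply (continuous_comp (fun t => 1 - t) f).
- apply (ex_derive_continuous (fun t => 1 - t)). auto_derive; auto.
- replace (1 - 1) with 0 by ring. exact Hf.
Qed.

Lemma tends_one_sub_inv_left_1 (f : R -> R) :
  continuous f 0 -> tends (at_left 1) (fun t => f (1 - / t)) (f 0).
Proof.
intros Hf. replace (f 0) with (f (1 - / 1)) by (f_equal; field).
apply (tends_left_of_continuous (fun t => f (1 - / t))).
apply (continuous_comp (fun t => 1 - / t) f).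
- apply (ex_derive_continuous (fun t => 1 - / t)). auto_derive; lra.
- replace (1 - / 1) with 0 by field. exact Hf.
Qed.

Lemma tends_polylog_one_sub (k : nat) :
  tends (at_left 1) (fun t => polylog k (1 - t)) 0.
Proof.
rewrite <- (polylog_0_r k) at 1. apply tends_one_sub_left_1, continuous_polylog. lra.
Qed.

Lemma tends_polylog_one_sub_inv (k : nat) :
  tends (at_left 1) (fun t => polylog k (1 - / t)) 0.
Proof.
rewrite <- (polylog_0_r k) at 1. apply tends_one_sub_inv_left_1, continuous_polylog. lra.
Qed.

Lemma tends_nielsen2_one_sub (k : nat) :
  tends (at_left 1) (fun t => nielsen2 k (1 - t)) 0.
Proof.
rewrite <- (nielsen2_0_r k) at 1. apply tends_one_sub_left_1, continuous_nielsen2. lra.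
Qed.

Lemma tends_nielsen2_one_sub_inv (k : nat) :
  tends (at_left 1) (fun t => nielsen2 k (1 - / t)) 0.
Proof.
rewrite <- (nielsen2_0_r k) at 1. apply tends_one_sub_inv_left_1, continuous_nielsen2. lra.
Qed.

Lemma tends_id_mul (f : R -> R) (l : R) :
  tends (at_left 1) f l -> tends (at_left 1) (fun t => t * f t) l.
Proof.
intros H. rewrite <- (Rmult_1_l l). apply (tends_mult (at_left 1)); auto.
apply (tends_left_of_continuous (fun t => t)), continuous_id.
Qed.

Lemma unit_series_avg_geom (k : nat) : unit_series (ipow k) (avg_iter k geom).
Proof.
intros x Hx.
eapply is_series_ext;
  [|exact (unit_series_avg_iter _ _ k continuous_below_geom unit_series_geom x Hx)].
intros n. real_eq. unfold ipow, Rdiv. ring.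
Qed.

Lemma tends_polylog (k : nat) : (2 <= k)%nat ->
  tends (at_left 1) (fun t => polylog k t) (zeta_nat k).
Proof.
intros Hk. apply (tends_id_mul (avg_iter k geom)).
apply unit_series_abel with (ipow k).
- intros n. assert (H := ipow_pos k n); lra.
- apply unit_series_avg_geom.
- now apply is_series_zeta_nat.
Qed.

Lemma tends_nielsen2 (k : nat) : (2 <= k)%nat ->
  tends (at_left 1) (fun t => nielsen2 k t) (mzv (S k) 1).
Proof.
intros Hk. apply (tends_id_mul (avg_iter (S k) log_geom)).
apply unit_series_abel with (mzv_term (S k) 1).
- intros n. apply Rmult_le_pos. assert (H := ipow_pos (S k) n); lra.
  apply psum_ipow_nonneg.
- intros x Hx.
  eapply is_series_ext; [|exact (unit_series_avg_iter _ _ (S k)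
    continuous_below_log_geom unit_series_log_geom x Hx)].
  intros n. real_eq. unfold mzv_term. rewrite <- harmonic_psum.
  unfold ipow, Rdiv. ring.
- apply Series_correct, ex_series_mzv; lia.
Qed.

Lemma tends_one_sub_mul_ln : tends (at_left 1) (fun t => (1 - t) * ln (1 - t)) 0.
Proof.
apply (filterlim_comp _ _ _ (fun t => 1 - t) (fun t => t * ln t) _ (at_right 0));
  [|apply tends_mul_ln].
intros P [e He]. exists e. intros t Ht Ht1. apply He; [|lra].
change (Rabs (t - 1) < e) in Ht. change (Rabs (1 - t - 0) < e).
replace (1 - t - 0) with (- (t - 1)) by ring. now rewrite Rabs_Ropp.
Qed.

(** A factor vanishing linearly at 1 beats the logarithmic singularity. *)
Lemma tends_ln_one_sub_mul (f : R -> R) (K : R) :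
  (forall t, 1 / 2 < t < 1 -> Rabs (f t) <= K * (1 - t)) ->
  tends (at_left 1) (fun t => ln (1 - t) * f t) 0.
Proof.
intros Hf.
apply (tends_squeeze (at_left 1) _ (fun t => - K * ((1 - t) * ln (1 - t)))).
- apply (at_left_of_interval (1 / 2) 1); [lra|]. intros t Ht.
  assert (ln (1 - t) < 0) by (rewrite <- ln_1; apply ln_increasing; lra).
  rewrite Rminus_0_r, Rabs_mult, (Rabs_left (ln (1 - t))) by auto.
  specialize (Hf t Ht). nra.
- rewrite <- (Rmult_0_r (- K)). apply (tends_mult (at_left 1)).
  apply tends_const; apply _. apply tends_one_sub_mul_ln.
Qed.

Lemma tends_ln_mul_ln : tends (at_left 1) (fun t => ln (1 - t) * ln t) 0.
Proof.
apply (tends_ln_one_sub_mul (fun t => ln t) 2). intros t Ht.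
assert (ln t < 0) by (rewrite <- ln_1; apply ln_increasing; lra).
rewrite Rabs_left by auto.
assert (H1 := ln_le_sub_1 (/ t) ltac:(apply Rinv_0_lt_compat; lra)).
rewrite ln_Rinv in H1 by lra.
apply Rle_trans with (/ t - 1); auto.
replace (/ t - 1) with ((1 - t) * / t) by (field; lra).
rewrite (Rmult_comm 2). apply Rmult_le_compat_l; [lra|].
replace 2 with (/ (1 / 2)) by field. apply Rinv_le_contravar; lra.
Qed.

(** The index 3 is the first for which the derivative of Li_k stays bounded at 1. *)
Lemma tends_ln_mul_polylog (k : nat) : (3 <= k)%nat ->
  tends (at_left 1) (fun t => ln (1 - t) * (polylog k t - zeta_nat k)) 0.
Proof.
intros Hk.
assert (Hp : forall n, 0 <= ipow k n) by (intros n; assert (H := ipow_pos k n); lra).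
assert (Hex : ex_series (fun n => INR n * ipow k n)).
{ apply (ex_series_le_ipow _ 1). intros n. split.
  - apply Rmult_le_pos; auto. apply pos_INR.
  - assert (H1 := ipow_le k 3 n Hk). rewrite (ipow_S 2) in H1.
    assert (H2 := INR_S_ge_1 n). assert (H3 := ipow_pos 2 n).
    apply Rle_trans with (INR (S n) * (ipow 2 n / INR (S n))).
    + apply Rmult_le_compat; auto. apply pos_INR. apply le_INR; lia.
    + right. field. lra. }
destruct Hex as [l' Hl'].
assert (Hz := is_series_zeta_nat k ltac:(lia)).
apply (tends_ln_one_sub_mul (fun t => polylog k t - zeta_nat k) (l' + zeta_nat k)).
intros t Ht.
destruct (unit_series_abel_rate _ _ _ _ t Hp (unit_series_avg_geom k) Hz Hl' ltac:(lra)) as [H1 H2].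
assert (H3 : 0 <= avg_iter k geom t).
{ apply (is_series_le (fun n => 0 * ipow k n) (fun n => ipow k n * t ^ n) 0).
  - intros n. specialize (Hp n). assert (0 <= t ^ n) by (apply pow_le; lra). nra.
  - rewrite <- (Rmult_0_l (zeta_nat k)) at 1.
    apply (is_series_scal (K := R_AbsRing) 0 (ipow k) (zeta_nat k) Hz).
  - apply unit_series_avg_geom. rewrite Rabs_pos_eq; lra. }
unfold polylog. rewrite Rabs_left1; nra.
Qed.

(** Computes the limit at 1 of a polynomial in the functions above.  The products
    with ln (1 - x) are recognized first, since that factor alone has no finite
    limit; identities must be written so that each ln (1 - x) stands directly in
    front of a vanishing factor. *)
Ltac limit_at_1 := lazymatch goal with
  | |- tends _ (fun x => ln x) _ => apply tends_ln_left_1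
  | |- tends _ (fun x => polylog _ (1 - x)) _ => apply tends_polylog_one_sub
  | |- tends _ (fun x => polylog _ (1 - / x)) _ => apply tends_polylog_one_sub_inv
  | |- tends _ (fun x => nielsen2 _ (1 - x)) _ => apply tends_nielsen2_one_sub
  | |- tends _ (fun x => nielsen2 _ (1 - / x)) _ => apply tends_nielsen2_one_sub_inv
  | |- tends _ (fun x => polylog _ x) _ => apply tends_polylog; lia
  | |- tends _ (fun x => nielsen2 _ x) _ => apply tends_nielsen2; lia
  | |- tends _ (fun x => ln (1 - x) * ln x) _ => apply tends_ln_mul_ln
  | |- tends _ (fun x => ln (1 - x) * (polylog _ x - _)) _ =>
      apply tends_ln_mul_polylog; lia
  | |- tends _ (fun x => @?f x + @?g x) _ =>
      apply (tends_plus (at_left 1) f g); limit_at_1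
  | |- tends _ (fun x => @?f x - @?g x) _ =>
      apply (tends_minus (at_left 1) f g); limit_at_1
  | |- tends _ (fun x => @?f x * @?g x) _ =>
      apply (tends_mult (at_left 1) f g); limit_at_1
  | |- tends _ (fun _ => ?c) _ => apply (tends_const (at_left 1) c)
  end.

Ltac derivative H := lazymatch goal with
  | |- is_derive (fun x => ln x) _ _ => apply (is_derive_ln_id _ H)
  | |- is_derive (fun x => ln (1 - x)) _ _ => apply (is_derive_ln_one_sub _ H)
  | |- is_derive (fun x => polylog (S ?k) (1 - x)) _ _ =>
      apply (is_derive_tower_one_sub _ H polylog is_derive_polylog k)
  | |- is_derive (fun x => polylog (S ?k) (1 - / x)) _ _ =>
      apply (is_derive_tower_one_sub_inv _ H polylog is_derive_polylog k)
  | |- is_derive (fun x => nielsen2 (S ?k) (1 - x)) _ _ =>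
      apply (is_derive_tower_one_sub _ H nielsen2 is_derive_nielsen2 k)
  | |- is_derive (fun x => nielsen2 (S ?k) (1 - / x)) _ _ =>
      apply (is_derive_tower_one_sub_inv _ H nielsen2 is_derive_nielsen2 k)
  | |- is_derive (fun x => polylog (S ?k) x) _ _ =>
      apply (is_derive_tower _ H polylog is_derive_polylog k)
  | |- is_derive (fun x => nielsen2 (S ?k) x) _ _ =>
      apply (is_derive_tower _ H nielsen2 is_derive_nielsen2 k)
  | |- is_derive (fun x => @?f x + @?g x) _ _ =>
      apply (is_derive_Rplus f g); derivative H
  | |- is_derive (fun x => @?f x - @?g x) _ _ =>
      apply (is_derive_Rminus f g); derivative H
  | |- is_derive (fun x => @?f x * @?g x) _ _ =>
      apply (is_derive_Rmult f g); derivative H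
  | |- is_derive (fun _ => ?c) _ _ => apply (is_derive_Rconst c)
  end.

(** * The identities between 1 - q, 1 - 1/q and q *)

(** Euler's reflection formula: the derivative of ln (1 - q) ln q cancels Li_1 of
    both arguments. *)
Lemma dilog_reflection (q : R) : 0 < q < 1 ->
  polylog 2 (1 - q) + polylog 2 q + ln (1 - q) * ln q = zeta_nat 2.
Proof.
apply (eq_of_derive_0
  (fun x => polylog 2 (1 - x) + polylog 2 x + ln (1 - x) * ln x)).
- intros t Ht. eapply is_derive_value; [derivative Ht|].
  rewrite (polylog_1_one_sub t Ht), polylog_1 by lra. field; lra.
- eapply tends_value; [limit_at_1|]. ring.
Qed.

(** Landen's identity at 1 - q, since 1 - 1/q = - (1 - q)/q. *)
Lemma dilog_landen (q : R) : 0 < q < 1 ->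
  polylog 2 (1 - / q) + polylog 2 (1 - q) + 1 / 2 * (ln q * ln q) = 0.
Proof.
apply (eq_of_derive_0
  (fun x => polylog 2 (1 - / x) + polylog 2 (1 - x) + 1 / 2 * (ln x * ln x))).
- intros t Ht. eapply is_derive_value; [derivative Ht|].
  rewrite (polylog_1_one_sub t Ht), (polylog_1_one_sub_inv t Ht) by lra. field; lra.
- eapply tends_value; [limit_at_1|]. ring.
Qed.

Lemma nielsen2_1_reflection (q : R) : 0 < q < 1 ->
  nielsen2 1 (1 - q) + polylog 3 q - ln q * polylog 2 q
  - 1 / 2 * (ln (1 - q) * ln q * ln q) = zeta_nat 3.
Proof.
apply (eq_of_derive_0 (fun q => nielsen2 1 (1 - q) + polylog 3 q
  - ln q * polylog 2 q - 1 / 2 * (ln (1 - q) * ln q * ln q))).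
- intros t Ht. eapply is_derive_value; [derivative Ht|].
  rewrite (nielsen2_0_one_sub t Ht), polylog_1 by lra. field; lra.
- eapply tends_value; [limit_at_1|]. ring.
Qed.

(** S_(0,2) takes the same value (ln q)^2 / 2 at 1 - q and at 1 - 1/q, so the
    two derivatives differ by (ln q)^2 / (2 q) only. *)
Lemma nielsen2_1_landen (q : R) : 0 < q < 1 ->
  nielsen2 1 (1 - / q) - nielsen2 1 (1 - q) + 1 / 6 * (ln q * ln q * ln q) = 0.
Proof.
apply (eq_of_derive_0 (fun q => nielsen2 1 (1 - / q) - nielsen2 1 (1 - q)
  + 1 / 6 * (ln q * ln q * ln q))).
- intros t Ht. eapply is_derive_value; [derivative Ht|].
  rewrite (nielsen2_0_one_sub t Ht), (nielsen2_0_one_sub_inv t Ht) by lra. field; lra.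
- eapply tends_value; [limit_at_1|]. ring.
Qed.

(** By [dilog_landen], the derivative of Li_3(1 - 1/q) + Li_3(1 - q) involves Li_2
    only through Li_2(1 - q) / q, which [dilog_reflection] combines with the
    derivative of Li_3(q). *)
Lemma trilog_three_term (q : R) : 0 < q < 1 ->
  polylog 3 (1 - / q) + polylog 3 (1 - q) + polylog 3 q - zeta_nat 2 * ln q
  - 1 / 6 * (ln q * ln q * ln q) + 1 / 2 * (ln (1 - q) * ln q * ln q) = zeta_nat 3.
Proof.
apply (eq_of_derive_0 (fun q => polylog 3 (1 - / q) + polylog 3 (1 - q)
  + polylog 3 q - zeta_nat 2 * ln q - 1 / 6 * (ln q * ln q * ln q)
  + 1 / 2 * (ln (1 - q) * ln q * ln q))).
- intros t Ht. eapply is_derive_value; [derivative Ht|].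
  assert (H1 := dilog_reflection t Ht). assert (H2 := dilog_landen t Ht).
  replace (polylog 2 (1 - / t)) with
    (- polylog 2 (1 - t) - 1 / 2 * (ln t * ln t)) by lra.
  rewrite <- H1. field; lra.
- eapply tends_value; [limit_at_1|]. ring.
Qed.

(** The coefficient of q/(1-q) in the derivative of [nielsen2_3_relation].  Its
    own derivative involves S_(1,2) only through the two relations of weight 3. *)
Lemma nielsen2_2_difference (q : R) : 0 < q < 1 ->
  nielsen2 2 (1 - / q) - nielsen2 2 (1 - q) - 2 * polylog 4 q
  + ln q * polylog 3 q + zeta_nat 3 * ln q - 1 / 24 * (ln q * ln q * ln q * ln q)
  + 1 / 6 * (ln (1 - q) * ln q * ln q * ln q) = - 2 * zeta_nat 4.
Proof.
apply (eq_of_derive_0 (fun q => nielsen2 2 (1 - / q) - nielsen2 2 (1 - q)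
  - 2 * polylog 4 q + ln q * polylog 3 q + zeta_nat 3 * ln q
  - 1 / 24 * (ln q * ln q * ln q * ln q)
  + 1 / 6 * (ln (1 - q) * ln q * ln q * ln q))).
- intros t Ht. eapply is_derive_value; [derivative Ht|].
  assert (H1 := nielsen2_1_reflection t Ht). assert (H2 := nielsen2_1_landen t Ht).
  replace (nielsen2 1 (1 - / t)) with
    (nielsen2 1 (1 - t) - 1 / 6 * (ln t * ln t * ln t)) by lra.
  rewrite <- H1. field; lra.
- eapply tends_value; [limit_at_1|]. ring.
Qed.

(** The coefficient of 1 in the derivative of [nielsen2_3_relation].  In its
    derivative S_(1,2)(q) appears as well, and is eliminated by the reflection
    formula with q and 1 - q exchanged.  The constant is 2 zeta(3,1) - 3 zeta(4). *)
Lemma nielsen2_2_sum (q : R) : 0 < q < 1 ->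
  nielsen2 2 (1 - / q) + 2 * nielsen2 2 q - 3 * polylog 4 q
  + polylog 4 (1 - / q) + polylog 4 (1 - q) - ln q * polylog 3 (1 - / q)
  + zeta_nat 3 * ln q + 2 * (ln (1 - q) * (polylog 3 q - zeta_nat 3))
  + 1 / 6 * (ln q * ln q * ln q * ln q)
  + 1 / 2 * ((ln (1 - q) * ln q) * (ln (1 - q) * ln q))
  - 1 / 2 * (ln (1 - q) * ln q * ln q * ln q)
  - 2 * zeta_nat 2 * (ln (1 - q) * ln q) + 3 / 2 * zeta_nat 2 * (ln q * ln q)
  = - 5 / 2 * zeta_nat 4.
Proof.
apply (eq_of_derive_0 (fun q => nielsen2 2 (1 - / q) + 2 * nielsen2 2 q
  - 3 * polylog 4 q
  + polylog 4 (1 - / q) + polylog 4 (1 - q) - ln q * polylog 3 (1 - / q)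
  + zeta_nat 3 * ln q + 2 * (ln (1 - q) * (polylog 3 q - zeta_nat 3))
  + 1 / 6 * (ln q * ln q * ln q * ln q)
  + 1 / 2 * ((ln (1 - q) * ln q) * (ln (1 - q) * ln q))
  - 1 / 2 * (ln (1 - q) * ln q * ln q * ln q)
  - 2 * zeta_nat 2 * (ln (1 - q) * ln q) + 3 / 2 * zeta_nat 2 * (ln q * ln q))).
- intros t Ht. eapply is_derive_value; [derivative Ht|].
  assert (H1 := nielsen2_1_reflection t Ht). assert (H2 := nielsen2_1_landen t Ht).
  assert (H3 := nielsen2_1_reflection (1 - t) ltac:(lra)).
  replace (1 - (1 - t)) with t in H3 by ring.
  assert (H4 := trilog_three_term t Ht).
  assert (H5 := dilog_reflection t Ht). assert (H6 := dilog_landen t Ht).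
  replace (nielsen2 1 (1 - / t)) with
    (nielsen2 1 (1 - t) - 1 / 6 * (ln t * ln t * ln t)) by lra.
  replace (nielsen2 1 (1 - t)) with (zeta_nat 3 - polylog 3 t + ln t * polylog 2 t
    + 1 / 2 * (ln (1 - t) * ln t * ln t)) by lra.
  replace (nielsen2 1 t) with (zeta_nat 3 - polylog 3 (1 - t)
    + ln (1 - t) * polylog 2 (1 - t) + 1 / 2 * (ln t * ln (1 - t) * ln (1 - t))) by lra.
  replace (polylog 3 (1 - / t)) with (zeta_nat 3 - polylog 3 (1 - t) - polylog 3 t
    + zeta_nat 2 * ln t + 1 / 6 * (ln t * ln t * ln t)
    - 1 / 2 * (ln (1 - t) * ln t * ln t)) by lra.
  replace (polylog 2 (1 - / t)) with
    (- polylog 2 (1 - t) - 1 / 2 * (ln t * ln t)) by lra.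
  rewrite <- H5. field; lra.
- eapply tends_value; [limit_at_1|]. rewrite mzv_3_1. field.
Qed.

(** The theorem in the variable q, with all powers of ln (1 - q) grouped with
    vanishing factors.  The constant is - 2 zeta(4,1) + 3 zeta(5). *)
Lemma nielsen2_3_relation (q : R) : 0 < q < 1 ->
  nielsen2 3 (1 - / q) - nielsen2 3 (1 - q) - 2 * nielsen2 3 q
  + 3 * polylog 5 q
  - ln q * (polylog 4 (1 - / q) + polylog 4 (1 - q) + polylog 4 q)
  - 2 * (ln (1 - q) * (polylog 4 q - zeta_nat 4))
  + ln q * (polylog 4 q - zeta_nat 4)
  - 1 / 30 * (ln q * ln q * ln q * ln q * ln q)
  - 1 / 6 * ((ln (1 - q) * ln q) * (ln (1 - q) * ln q) * ln q)
  + 1 / 8 * (ln (1 - q) * ln q * ln q * ln q * ln q)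
  + 2 * zeta_nat 3 * (ln (1 - q) * ln q) - 1 / 2 * zeta_nat 3 * (ln q * ln q)
  + zeta_nat 2 * (ln (1 - q) * ln q * ln q)
  - 1 / 2 * zeta_nat 2 * (ln q * ln q * ln q) - 3 / 2 * zeta_nat 4 * ln q
  = 2 * zeta_nat 2 * zeta_nat 3 - zeta_nat 5.
Proof.
apply (eq_of_derive_0 (fun q => nielsen2 3 (1 - / q) - nielsen2 3 (1 - q)
  - 2 * nielsen2 3 q + 3 * polylog 5 q
  - ln q * (polylog 4 (1 - / q) + polylog 4 (1 - q) + polylog 4 q)
  - 2 * (ln (1 - q) * (polylog 4 q - zeta_nat 4))
  + ln q * (polylog 4 q - zeta_nat 4)
  - 1 / 30 * (ln q * ln q * ln q * ln q * ln q)
  - 1 / 6 * ((ln (1 - q) * ln q) * (ln (1 - q) * ln q) * ln q)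
  + 1 / 8 * (ln (1 - q) * ln q * ln q * ln q * ln q)
  + 2 * zeta_nat 3 * (ln (1 - q) * ln q) - 1 / 2 * zeta_nat 3 * (ln q * ln q)
  + zeta_nat 2 * (ln (1 - q) * ln q * ln q)
  - 1 / 2 * zeta_nat 2 * (ln q * ln q * ln q) - 3 / 2 * zeta_nat 4 * ln q)).
- intros t Ht. eapply is_derive_value; [derivative Ht|].
  assert (H1 := nielsen2_2_difference t Ht). assert (H2 := nielsen2_2_sum t Ht).
  assert (H3 := trilog_three_term t Ht).
  replace (nielsen2 2 (1 - t)) with (nielsen2 2 (1 - / t) + (2 * zeta_nat 4
    - 2 * polylog 4 t
    + ln t * polylog 3 t + zeta_nat 3 * ln t - 1 / 24 * (ln t * ln t * ln t * ln t)
    + 1 / 6 * (ln (1 - t) * ln t * ln t * ln t))) by lra.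
  replace (nielsen2 2 t) with (1 / 2 * (- 5 / 2 * zeta_nat 4
    - (nielsen2 2 (1 - / t) - 3 * polylog 4 t
    + polylog 4 (1 - / t) + polylog 4 (1 - t) - ln t * polylog 3 (1 - / t)
    + zeta_nat 3 * ln t + 2 * (ln (1 - t) * (polylog 3 t - zeta_nat 3))
    + 1 / 6 * (ln t * ln t * ln t * ln t)
    + 1 / 2 * ((ln (1 - t) * ln t) * (ln (1 - t) * ln t))
    - 1 / 2 * (ln (1 - t) * ln t * ln t * ln t)
    - 2 * zeta_nat 2 * (ln (1 - t) * ln t) + 3 / 2 * zeta_nat 2 * (ln t * ln t)))) by lra.
  replace (polylog 3 (1 - t)) with (zeta_nat 3 - polylog 3 (1 - / t) - polylog 3 t
    + zeta_nat 2 * ln t + 1 / 6 * (ln t * ln t * ln t)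
    - 1 / 2 * (ln (1 - t) * ln t * ln t)) by lra.
  field; lra.
- eapply tends_value; [limit_at_1|]. rewrite mzv_4_1. field.
Qed.

Lemma nielsen2_3_relation_exp (z : R) : 0 < z ->
  let p := exp (2 * z) in
  let q := exp (- 2 * z) in
  let L := ln (2 * sinh z) in
  nielsen2 3 (1 - p) - nielsen2 3 (1 - q) - 2 * nielsen2 3 q =
   - 3 * polylog 5 q
   - 2 * z * (polylog 4 (1 - p) + polylog 4 (1 - q) + polylog 4 q)
   + 2 * L * polylog 4 q
   + (- (2 * z ^ 5 / 5) - 4 * z ^ 3 / 3 * L ^ 2
      + 2 * L * (z ^ 4 / 3 - zeta 4 + 2 * z * zeta 3 - 2 * z ^ 2 * zeta 2)
      - 2 * z ^ 2 * zeta 3 - 3 * z * zeta 4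
      + 2 * zeta 2 * zeta 3 - zeta 5).
Proof.
intros Hz p q L.
assert (Hq : 0 < q < 1).
{ split; [apply exp_pos|]. rewrite <- exp_0. apply exp_increasing. lra. }
assert (Ep : p = / q).
{ unfold p, q. rewrite <- exp_Ropp. f_equal. ring. }
assert (El : ln q = - 2 * z) by apply ln_exp.
assert (EL : L = ln (1 - q) + z).
{ unfold L. replace (2 * sinh z) with (exp z * (1 - q)).
  - rewrite ln_mult, ln_exp; [ring|apply exp_pos|lra].
  - unfold sinh, q. replace (- 2 * z) with (- z + - z) by ring.
    rewrite exp_plus.
    assert (E : exp z * exp (- z) = 1) by (rewrite <- exp_plus, Rplus_opp_r; apply exp_0).
    replace (exp z * (1 - exp (- z) * exp (- z)))
      with (exp z - exp z * exp (- z) * exp (- z)) by ring.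
    rewrite E. field. }
rewrite (zeta_eq_zeta_nat 2 2), (zeta_eq_zeta_nat 3 3), (zeta_eq_zeta_nat 4 4),
  (zeta_eq_zeta_nat 5 5) by (simpl; ring).
assert (H := nielsen2_3_relation q Hq). rewrite El in H.
rewrite Ep, EL. apply Rminus_diag_uniq. rewrite <- (Rminus_diag_eq _ _ H). field.
Qed.

Theorem lemma6p2 :
  forall z : R, 0 < z ->
  let p : C := RtoC (exp (2 * z)) in
  let q : C := RtoC (exp (- 2 * z)) in
  let L : R := ln (2 * sinh z) in
  (nielsen 3 2 (1 - p) - nielsen 3 2 (1 - q) - 2 * nielsen 3 2 q =
   - 3 * Li 5 q
   - 2 * z * (Li 4 (1 - p) + Li 4 (1 - q) + Li 4 q)
   + 2 * L * Li 4 q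
   + RtoC (- (2 * z ^ 5 / 5) - 4 * z ^ 3 / 3 * L ^ 2
           + 2 * L * (z ^ 4 / 3 - zeta 4 + 2 * z * zeta 3 - 2 * z ^ 2 * zeta 2)
           - 2 * z ^ 2 * zeta 3 - 3 * z * zeta 4
           + 2 * zeta 2 * zeta 3 - zeta 5))%C.
Proof.
intros z Hz p q L.
assert (Hp0 : 0 < exp (2 * z)) by apply exp_pos.
assert (Hq0 : 0 < exp (- 2 * z)) by apply exp_pos.
assert (Hq1 : exp (- 2 * z) < 1).
{ rewrite <- exp_0. apply exp_increasing. lra. }
assert (H := nielsen2_3_relation_exp z Hz). cbv zeta in H.
unfold p, q, L. rewrite <- !RtoC_minus, !nielsen_3_2_real, !Li_real by lra.
match goal with |- context [RtoC (- (2 * z ^ 5 / 5) - ?a + ?b - ?c - ?d + ?e - ?f)] =>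
  set (P := - (2 * z ^ 5 / 5) - a + b - c - d + e - f) in * end.
apply injective_projections; cbn [fst snd RtoC Cplus Cminus Copp Cmult].
- lra.
- ring.
Qed.
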